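(* Let $X$ and $H$ be Hopf algebras with bicovariant differential calculi and $\pi:X\to H$ a differentiable surjective Hopf algebra map. Suppose that $\pi$ satisfies condition K and that $H$ has a normalised left integral. Let $B=X^{\mathrm{co}H}$. Then, for all $n\ge 1$, under the isomorphism $\Omega^nX\cong (L^1X)^{\wedge n}\otimes X$, $$\Omega^nB=(\mathcal{K}^{\wedge n}\otimes X)^{\mathrm{co}H}$$ (co-invariants for the tensor product coaction).
   Context: Algebras are unital over a field $k$; Hopf algebras have bijective antipode $S$; Sweedler notation $\Delta x=x_{(1)}\otimes x_{(2)}$. A differential calculus on $A$ is a differential graded algebra $(\mathrm{d},\Omega^*A)$ with $\Omega^0A=A$, product $\wedge$, satisfying the density condition $\Omega^{n+1}A\subset A.\mathrm{d}\Omega^nA$. An algebra map is differentiable if it extends to a map (subscript $*$) of differential graded algebras; $\Omega^*(A\otimes C)=\Omega^*A\otimes\Omega^*C$ is the graded tensor product. The calculi on $X$, $H$ are bicovariant, meaning that the coproducts are differentiable, and higher forms are given by Woronowicz's construction recalled below. The left coaction $\xi\mapsto\xi_{[-1]}\otimes\xi_{[0]}\in X\otimes\Omega^nX$ and the right coaction $\xi\mapsto\xi_{[0]}\otimes\xi_{[1]}\in\Omega^nX\otimes X$ are the components of $\Delta_*$ in these spaces. $L^1X=\{\xi\in\Omega^1X:\xi_{[-1]}\otimes\xi_{[0]}=1\otimes\xi\}$ (similarly $L^1H$). $X$ acts on the left of $L^1X$ by $x\triangleright\eta=x_{(2)}\,\eta\,S^{-1}(x_{(1)})$. The braiding on $L^1X\otimes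 L^1X$ is $\sigma(\xi\otimes\eta)=\eta_{[0]}\otimes S(\eta_{[1]})\triangleright\xi$, and $(L^1X)^{\wedge n}$ is the quotient of $(L^1X)^{\otimes n}$ by the subspace spanned by the elements lying in $\ker(\sigma-\mathrm{id})$ in some pair of adjacent tensor factors. By definition of the higher forms, $\Omega^nX\cong(L^1X)^{\wedge n}\otimes X$, the inverse of $\xi\otimes x\mapsto\xi x$, with $(\xi\otimes x)\wedge(\eta\otimes y)=\xi\wedge(x_{(2)}\triangleright\eta)\otimes x_{(1)}y$. The same applies to $H$. The right $H$-coaction on $X$ is $\rho=(\mathrm{id}\otimes\pi)\Delta$; $B=X^{\mathrm{co}H}=\{b\in X:\rho(b)=b\otimes1_H\}$. The calculus on $B$ is $\Omega^1B=B.\mathrm{d}B\subset\Omega^1X$ and $\Omega^nB=\bigwedge^n\Omega^1B\subset\Omega^nX$ (span of $n$-fold wedge products). $\mathcal{K}=\ker(\pi_*:L^1X\to L^1H)$, and $\mathcal{K}^{\wedge n}\subset(L^1X)^{\wedge n}$ is the span of $n$-fold wedge products of elements of $\mathcal{K}$. The right $H$-coaction on $L^1X$ is $\xi\mapsto\xi_{[0]}\otimes\pi(\xi_{[1]})$; it restricts to $\mathcal{K}$, and $\mathcal{K}^{\wedge n}\otimes X$ has the resulting tensor product coaction. Condition K: $\mathcal{K}\subset\mathrm{d}B.X$. A normalised left integral on $H$ is a linear map $\int:H\to k$ with $(\mathrm{id}\otimes\int)\Delta_H=1_H.\int$ and $\int1_H=1$. *)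

(* Defs.v *)
Set Warnings "-notation-overridden,-ambiguous-paths,-redundant-canonical-projection,-projection-no-head-constant".
From HB Require Import structures.
From mathcomp Require Import all_boot all_algebra.
From mathcomp Require Import boolp classical_sets.
From mathcomp Require Import freeg.

Set Implicit Arguments.
Unset Strict Implicit.
Unset Printing Implicit Defensive.

Import GRing.Theory.
Local Open Scope ring_scope.
Local Open Scope quotient_scope.
Local Open Scope classical_set_scope.

Reserved Notation "U ⊗ V" (at level 40, left associativity).
Reserved Notation "u ⊙ v" (at level 40, left associativity).

Section Span.
Variables (k : fieldType) (V : lmodType k).

Definition lspan (A : set V) : {pred V} := fun v =>
  `[< exists2 s : seq (k * V),
        (forall p, p \in s -> A p.2) & v = \sum_(p <- s) p.1 *: p.2 >].

Lemma lspanP (A : set V) (v : V) :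
  reflect (exists2 s : seq (k * V),
             (forall p, p \in s -> A p.2) & v = \sum_(p <- s) p.1 *: p.2)
          (v \in lspan A).
Proof. exact: asboolP. Qed.

Lemma lspan_submod (A : set V) : subsemimod_closed (lspan A).
Proof.
split; first split.
- by apply/lspanP; exists [::]; rewrite ?big_nil.
- move=> u v /lspanP[s As ->] /lspanP[t At ->]; apply/lspanP.
  exists (s ++ t); last by rewrite big_cat.
  by move=> p; rewrite mem_cat => /orP[/As|/At].
- move=> a v /lspanP[s As ->]; apply/lspanP.
  exists [seq (a * p.1, p.2) | p <- s].
    by move=> p /mapP[q /As Aq ->].
  by rewrite big_map scaler_sumr; apply: eq_bigr => p _; rewrite scalerA.
Qed.

HB.instance Definition _ (A : set V) :=
  GRing.isSubmodClosed.Build k V (lspan A) (lspan_submod A).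

Lemma mem_lspan (A : set V) v : A v -> v \in lspan A.
Proof.
move=> Av; apply/lspanP; exists [:: (1, v)].
  by move=> p; rewrite inE => /eqP->.
by rewrite big_seq1 scale1r.
Qed.

Lemma lspan_min (A : set V) (S : submodClosed V) :
  (forall v, A v -> v \in S) -> {subset lspan A <= S}.
Proof.
move=> AS v /lspanP[s As ->]; rewrite big_seq.
by apply: rpred_sum => p /As /AS Sp; rewrite rpredZ.
Qed.

End Span.

Lemma linear_lspan0 (k : fieldType) (V W : lmodType k) (f : {linear V -> W})
    (A : set V) :
  (forall v, A v -> f v = 0) -> forall v, v \in lspan A -> f v = 0.
Proof.
move=> fA v /lspanP[s As ->]; rewrite raddf_sum /= big_seq big1 // => p /As.
by move=> /fA; rewrite linearZ /= => ->; rewrite scaler0.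
Qed.

(* V / span A.  [qlift f] is a total function (f applied to a chosen
   representative); it is the induced map as soon as f kills A, see
   [qlift_qproj]. *)
Section Quotient.
Variables (k : fieldType) (V : lmodType k) (A : set V).

Definition qmod := Quotient.quot (lspan A).
HB.instance Definition _ := GRing.Zmodule.on qmod.

Definition qproj (v : V) : qmod := \pi v.
Definition qlift (W : Type) (f : V -> W) (q : qmod) : W := f (repr q).

Lemma qproj_repr (q : qmod) : qproj (repr q) = q.
Proof. by rewrite /qproj reprK. Qed.

Lemma qproj_eq (u v : V) : (qproj u == qproj v) = (u - v \in lspan A).
Proof. by rewrite /qproj -Quotient.idealrBE. Qed.

Lemma qproj_additive : zmod_morphism qproj.
Proof. by move=> u v; rewrite /qproj; exact: raddfB. Qed.
HB.instance Definition _ :=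
  GRing.isZmodMorphism.Build V qmod qproj qproj_additive.

Definition qscale (a : k) (q : qmod) : qmod := qproj (a *: repr q).

Lemma qproj_scale a v : qproj (a *: v) = qscale a (qproj v).
Proof.
apply/eqP; rewrite qproj_eq -scalerBr rpredZ // -qproj_eq qproj_repr.
exact: eqxx.
Qed.

Lemma qscaleA a b q : qscale a (qscale b q) = qscale (a * b) q.
Proof. by rewrite -{1}[q]qproj_repr -!qproj_scale scalerA qproj_scale qproj_repr. Qed.
Lemma qscale1 q : qscale 1 q = q.
Proof. by rewrite -[q]qproj_repr -qproj_scale scale1r. Qed.
Lemma qscaleDr : right_distributive qscale +%R.
Proof.
move=> a p q; rewrite -[p]qproj_repr -[q]qproj_repr -raddfD -!qproj_scale.
by rewrite scalerDr raddfD.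
Qed.
Lemma qscaleDl q a b : qscale (a + b) q = qscale a q + qscale b q.
Proof. by rewrite -[q]qproj_repr -!qproj_scale scalerDl raddfD. Qed.

HB.instance Definition _ := GRing.Zmodule_isLmodule.Build k qmod
  qscaleA qscale1 qscaleDr qscaleDl.

Lemma qproj_scalable : scalable qproj.
Proof. by move=> a v; rewrite qproj_scale. Qed.
HB.instance Definition _ :=
  GRing.isScalable.Build k V qmod *:%R qproj qproj_scalable.

Lemma qlift_qproj (W : lmodType k) (f : {linear V -> W}) :
  (forall v, A v -> f v = 0) -> forall v, qlift f (qproj v) = f v.
Proof.
move=> fA v; apply/eqP; rewrite -subr_eq0 -raddfB; apply/eqP.
by apply: (linear_lspan0 fA); rewrite -qproj_eq qproj_repr.
Qed.

Lemma qlift_linear (W : lmodType k) (f : {linear V -> W}) :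
  (forall v, A v -> f v = 0) -> linear (qlift f : qmod -> W).
Proof.
move=> fA a p q; rewrite -[p]qproj_repr -[q]qproj_repr -linearP.
by rewrite !qlift_qproj // linearP.
Qed.

End Quotient.

Arguments qproj {k V} A v.
Arguments qlift {k V A W} f q.


Section FreeLift.
Variables (k : fieldType) (T : choiceType) (W : lmodType k) (f : T -> W).

HB.instance Definition _ := GRing.isZmodMorphism.Build {freeg T / k} W
  (fglift f) (lift_is_additive f).

Lemma fgliftE D : fglift f D = \sum_(x <- dom D) coeff x D *: f x.
Proof.
rewrite -{1}[D]freeg_sumE raddf_sum /=.
by apply: eq_bigr => x _; rewrite liftU.
Qed.

Lemma fglift_scalable : scalable (fglift f).
Proof.
move=> a D; rewrite [in RHS]fgliftE scaler_sumr.
have -> : a *: D = fgscale a D by [].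
rewrite /fgscale raddf_sum /=.
by apply: eq_bigr => x _; rewrite liftU scalerA.
Qed.
HB.instance Definition _ := GRing.isScalable.Build k {freeg T / k} W *:%R
  (fglift f) fglift_scalable.
End FreeLift.

(* U ⊗ V is the free module on U * V modulo the bilinearity relations.  As for
   [qlift], [tlift f] is total and is the linear map induced by f when f is
   bilinear, see [tlift_pure] and [tlift_linear]. *)
Section Tensor.
Variables (k : fieldType) (U V : lmodType k).

Local Notation delta u v := (<< ((u : U), (v : V)) >> : {freeg (U * V)%type / k}).

Variant tens_rel : set {freeg (U * V)%type / k} :=
| TensDl u u' v : tens_rel (delta (u + u') v - delta u v - delta u' v)
| TensDr u v v' : tens_rel (delta u (v + v') - delta u v - delta u v')
| TensZl a u v : tens_rel (delta (a *: u) v - a *: delta u v)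
| TensZr a u v : tens_rel (delta u (a *: v) - a *: delta u v).

Definition tens : Type := qmod tens_rel.
HB.instance Definition _ := GRing.Lmodule.on tens.

Definition tpure (u : U) (v : V) : tens := qproj tens_rel (delta u v).
Definition tlift (W : lmodType k) (f : U -> V -> W) (t : tens) : W :=
  qlift (fglift (fun p : U * V => f p.1 p.2)) t.

Lemma tpureDl u u' v : tpure (u + u') v = tpure u v + tpure u' v.
Proof.
apply/eqP; rewrite -raddfD qproj_eq opprD addrA.
by apply: mem_lspan; exact: TensDl.
Qed.
Lemma tpureDr u v v' : tpure u (v + v') = tpure u v + tpure u v'.
Proof.
apply/eqP; rewrite -raddfD qproj_eq opprD addrA.
by apply: mem_lspan; exact: TensDr.
Qed.
Lemma tpureZl a u v : tpure (a *: u) v = a *: tpure u v.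
Proof.
by apply/eqP; rewrite -linearZ qproj_eq; apply: mem_lspan; exact: TensZl.
Qed.
Lemma tpureZr a u v : tpure u (a *: v) = a *: tpure u v.
Proof.
by apply/eqP; rewrite -linearZ qproj_eq; apply: mem_lspan; exact: TensZr.
Qed.

Lemma tpure_bilinear : bilinear_for *:%R *:%R tpure.
Proof.
split=> [v a u u'|u a v v'] /=.
  by rewrite tpureDl tpureZl.
by rewrite tpureDr tpureZr.
Qed.
HB.instance Definition _ := bilinear_isBilinear.Build k U V tens
  *:%R *:%R tpure tpure_bilinear.

Lemma tens_ind (P : tens -> Prop) :
  P 0 -> (forall u v t, P t -> P (tpure u v + t)) -> forall t, P t.
Proof.
move=> P0 PD t; rewrite -[t]qproj_repr -[X in qproj _ X]freeg_sumE.
rewrite raddf_sum /=; elim/big_rec: _ => // -[u v] y _ Py.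
set c := coeff _ _.
have -> : << c *g (u, v) >> = c *: delta u v :> {freeg (U * V)%type / k}.
  by apply/eqP/freeg_eqP => p; rewrite coeffZ !coeffU mul1r.
suff -> : qproj tens_rel (c *: delta u v) = tpure (c *: u) v by exact: PD.
by rewrite tpureZl linearZ.
Qed.

Lemma tliftE (W : lmodType k) (f : U -> V -> W) t :
  tlift f t =
  \sum_(p <- dom (repr t)) coeff p (repr t) *: f p.1 p.2.
Proof. exact: fgliftE. Qed.

Lemma eq_tlift (W : lmodType k) (f g : U -> V -> W) :
  f =2 g -> tlift f =1 tlift g.
Proof. by move=> fg t; rewrite !tliftE; apply: eq_bigr => p _; rewrite fg. Qed.

Lemma tlift_funP (W : lmodType k) a (f g : U -> V -> W) t :
  tlift (fun u v => a *: f u v + g u v) t = a *: tlift f t + tlift g t.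
Proof.
rewrite !tliftE scaler_sumr -big_split /=; apply: eq_bigr => p _.
by rewrite scalerDr !scalerA mulrC.
Qed.

Lemma linear_tlift (W W' : lmodType k) (h : {linear W -> W'})
    (f : U -> V -> W) t :
  h (tlift f t) = tlift (fun u v => h (f u v)) t.
Proof.
rewrite !tliftE raddf_sum /=; apply: eq_bigr => p _.
by rewrite linearZ.
Qed.

Section Lift.
Variables (W : lmodType k) (f : U -> V -> W).
Hypothesis f_bilinear : bilinear_for *:%R *:%R f.

Let f_rel (d : {freeg (U * V)%type / k}) : tens_rel d ->
  fglift (fun p : U * V => f p.1 p.2) d = 0.
Proof.
have [fl fr] := f_bilinear.
have fDl u u' v : f (u + u') v = f u v + f u' v.
  by have /= := fl v 1 u u'; rewrite !scale1r.
have fDr u v v' : f u (v + v') = f u v + f u v'.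
  by have /= := fr u 1 v v'; rewrite !scale1r.
have f0l v : f 0 v = 0 by apply: (addrI (f 0 v)); rewrite -fDl !addr0.
have f0r u : f u 0 = 0 by apply: (addrI (f u 0)); rewrite -fDr !addr0.
have fZl a u v : f (a *: u) v = a *: f u v.
  by have /= := fl v a u 0; rewrite !addr0 f0l addr0.
have fZr a u v : f u (a *: v) = a *: f u v.
  by have /= := fr u a v 0; rewrite !addr0 f0r addr0.
case=> *; rewrite !raddfB /= ?linearZ /= !liftU /= !scale1r
  ?(fDl, fDr, fZl, fZr) ?scalerN ?subrr //; by rewrite addrAC addrK subrr.
Qed.

Lemma tlift_pure u v : tlift f (tpure u v) = f u v.
Proof.
by rewrite [LHS](qlift_qproj (f := fglift _) f_rel) /= liftU /= scale1r.
Qed.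

Lemma tlift_linear : linear (tlift f).
Proof. exact: (qlift_linear (f := fglift _) f_rel). Qed.

End Lift.
End Tensor.

Notation "U ⊗ V" := (tens U V) : type_scope.
Notation "u ⊙ v" := (tpure u v) : ring_scope.

Lemma tens_ext (k : fieldType) (U V W : lmodType k) (f g : {linear U ⊗ V -> W}) :
  (forall u v, f (u ⊙ v) = g (u ⊙ v)) -> f =1 g.
Proof.
move=> fg; elim/tens_ind => [|u v t IH]; first by rewrite !linear0.
by rewrite !linearD fg IH.
Qed.

Definition tmap (k : fieldType) (U V U' V' : lmodType k)
  (f : U -> U') (g : V -> V') : U ⊗ V -> U' ⊗ V' :=
  tlift (fun u v => f u ⊙ g v).
Definition tassoc (k : fieldType) (U V W : lmodType k) :
    (U ⊗ V) ⊗ W -> U ⊗ (V ⊗ W) :=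
  tlift (fun t w => tlift (fun u v => u ⊙ (v ⊙ w)) t).

Section Tmap.
Variables (k : fieldType) (U V U' V' : lmodType k).
Variables (f : {linear U -> U'}) (g : {linear V -> V'}).

Let tmap_bilin : bilinear_for *:%R *:%R (fun u v => f u ⊙ g v).
Proof.
split=> [v a u u'|u a v v'] /=.
  by rewrite linearP tpureDl tpureZl.
by rewrite linearP tpureDr tpureZr.
Qed.

Lemma tmap_pure u v : tmap f g (u ⊙ v) = f u ⊙ g v.
Proof. exact: tlift_pure. Qed.
Lemma tmap_linear : linear (tmap f g).
Proof. exact: tlift_linear. Qed.
HB.instance Definition _ :=
  GRing.isLinear.Build k (U ⊗ V) (U' ⊗ V') *:%R (tmap f g) tmap_linear.
End Tmap.

Section Tassoc.
Variables (k : fieldType) (U V W : lmodType k).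

Let bilin1 (w : W) : bilinear_for *:%R *:%R (fun (u : U) (v : V) => u ⊙ (v ⊙ w)).
Proof.
split=> [v a u u'|u a v v'] /=.
  by rewrite tpureDl tpureZl.
by rewrite tpureDl tpureZl tpureDr tpureZr.
Qed.

Let bilin2 : bilinear_for *:%R *:%R
  (fun (t : U ⊗ V) (w : W) => tlift (fun u v => u ⊙ (v ⊙ w)) t).
Proof.
split=> [w a t t'|t a w w'] /=; first exact: tlift_linear.
rewrite -tlift_funP; apply: eq_tlift => u v.
by rewrite !(tpureDr, tpureZr).
Qed.

Lemma tassoc_pure u v w : tassoc ((u ⊙ v) ⊙ w) = u ⊙ (v ⊙ w) :> U ⊗ (V ⊗ W).
Proof. by rewrite /tassoc tlift_pure ?tlift_pure. Qed.
Lemma tassoc_linear : linear (@tassoc k U V W).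
Proof. exact: tlift_linear. Qed.
HB.instance Definition _ := GRing.isLinear.Build k
  ((U ⊗ V) ⊗ W) (U ⊗ (V ⊗ W)) *:%R (@tassoc k U V W) tassoc_linear.
End Tassoc.

Section Functional.
Variables (k : fieldType) (V : lmodType k).

(* Needed for 1 ⊙ 1 <> 0 in a tensor product of algebras. *)
Lemma functional_ex (v : V) :
  v != 0 -> exists f : {linear V -> k^o}, f v = 1.
Proof.
move=> v0.
pose P (A : set V) := subsemimod_closed (mem A) /\ ~ A v \/ A = set0.
have [A [PA Amax]] : exists A, P A /\ forall B, A `<` B -> ~ P B.
  apply: Zorn_bigcup => F FP Ftot.
  have [[A [FA [u Au]]]|F0] := pselect (exists A, F A /\ A !=set0); last first.
    right; apply/seteqP; split=> // x [A FA Ax]; apply: F0.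
    by exists A; split => //; exists x.
  have FP' B x : F B -> B x -> subsemimod_closed (mem B) /\ ~ B v.
    by move=> FB Bx; have [//|B0] := FP _ FB; rewrite B0 in Bx.
  left; split; last by move=> [B FB Bv]; have [_] := FP' _ _ FB Bv; apply.
  split; first split.
  - have [[[A0 _] _] _] := FP' _ _ FA Au.
    by rewrite inE; exists A => //; rewrite inE in A0.
  - move=> x y; rewrite !inE => -[B FB Bx] [C FC Cy].
    have [[[_ BD] _] _] := FP' _ _ FB Bx.
    have [[[_ CD] _] _] := FP' _ _ FC Cy.
    have [BC|CB] := Ftot _ _ FB FC.
      by exists C => //; apply/set_mem/CD; rewrite inE //; apply: BC.
    by exists B => //; apply/set_mem/BD; rewrite inE //; apply: CB.
  - move=> a x; rewrite !inE => -[B FB Bx].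
    have [[_ BZ] _] := FP' _ _ FB Bx.
    by exists B => //; apply/set_mem/BZ; rewrite inE.
have {PA} [[[A0 AD] AZ] Av] : subsemimod_closed (mem A) /\ ~ A v.
  case: PA => // A0; exfalso; apply: (Amax [set 0]).
    by rewrite A0; split=> // /(_ 0 erefl).
  left; split; last by move=> /= vE; rewrite vE eqxx in v0.
  split; first split; first by rewrite inE.
    by move=> x y; rewrite !inE => -> ->; rewrite /= addr0.
  by move=> a x; rewrite !inE => ->; rewrite /= scaler0.
have AB x y : A x -> A y -> A (x - y).
  move=> Ax Ay; apply/set_mem/AD; rewrite ?inE // -scaleN1r.
  by apply/set_mem/AZ; rewrite inE.
have dec w : exists c, A (w - c *: v).
  have [Aw|nAw] := pselect (A w); first by exists 0; rewrite scale0r subr0.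
  pose B : set V := [set x | exists c, A (x - c *: w)].
  have [[c]|nBv] := pselect (B v).
    have [->|c0 Ac] := eqVneq c 0; first by rewrite scale0r subr0.
    exists c^-1; apply/set_mem.
    have /(AZ (- c^-1)) : v - c *: w \in A by rewrite inE.
    by rewrite scalerBr scalerA mulNr mulVf // scaleN1r opprK scaleNr addrC.
  exfalso; apply: (Amax B).
    split=> [x Ax|BA]; first by exists 0; rewrite scale0r subr0.
    apply: nAw; apply: BA; exists 1; rewrite scale1r subrr.
    by rewrite inE in A0.
  left; split=> //; split; first split.
  - by rewrite inE; exists 0; rewrite scale0r subr0; rewrite inE in A0.
  - move=> x y; rewrite !inE => -[c Ac] [d Ad]; exists (c + d).
    rewrite scalerDl opprD addrACA; apply/set_mem/AD; by rewrite inE.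
  - move=> a x; rewrite !inE => -[c Ac]; exists (a * c).
    by rewrite -scalerA -scalerBr; apply/set_mem/AZ; rewrite inE.
have uniqc w c d : A (w - c *: v) -> A (w - d *: v) -> c = d.
  move=> Ac Ad; have := AB _ _ Ad Ac.
  rewrite opprB addrC addrA subrK -scalerBl => Acd.
  apply/eqP; rewrite -subr_eq0; apply/negP => /negP cd0; apply: Av.
  move: cd0 => cd0; have /(AZ (c - d)^-1) : (c - d) *: v \in A by rewrite inE.
  by rewrite scalerA mulVf // scale1r inE.
pose f w : k^o := projT1 (cid (dec w)).
have fP w : A (w - f w *: v) by rewrite /f; case: cid.
have f_lin : linear f.
  move=> a x y; apply: (uniqc (a *: x + y)); first exact: fP.
  rewrite scalerDl opprD addrACA; apply/set_mem/AD; rewrite inE //.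
  by rewrite -scalerA -scalerBr; apply/set_mem/AZ; rewrite inE.
pose fL : {linear V -> k^o} :=
  HB.pack f (GRing.isLinear.Build k V k^o *:%R f f_lin).
exists fL; apply: (uniqc v); first exact: fP.
by rewrite scale1r subrr; rewrite inE in A0.
Qed.

Lemma tpure_neq0 (U : lmodType k) (v : V) (u : U) :
  (exists f : {linear U -> k^o}, f u = 1) -> v != 0 -> u ⊙ v != 0.
Proof.
move=> [f fu] /functional_ex[g gv]; apply/eqP => uv0.
pose F (x : U) (y : V) : k^o := f x * g y.
have FP : bilinear_for *:%R *:%R F.
  split=> [y a x x'|x a y y']; rewrite /F /= linearP /=.
    by rewrite mulrDl scalerAl.
  by rewrite mulrDr scalerAr.
have := tlift_pure FP u v; rewrite uv0 /F fu gv mulr1.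
pose L : {linear U ⊗ V -> k^o} :=
  HB.pack (tlift F) (GRing.isLinear.Build k _ _ _ _ (tlift_linear FP)).
by rewrite -[tlift F]/(L : _ -> _) linear0 => /esym/eqP; rewrite oner_eq0.
Qed.
End Functional.

Section TensorAlgebra.
Variables (k : fieldType) (A C : algType k).

Definition tmul (s t : A ⊗ C) : A ⊗ C :=
  tlift (fun a c => tlift (fun a' c' => (a * a') ⊙ (c * c')) t) s.

Let bilin1 a c : bilinear_for *:%R *:%R
  (fun (a' : A) (c' : C) => (a * a') ⊙ (c * c')).
Proof.
split=> [y b x x'|x b y y'] /=.
  by rewrite mulrDr tpureDl -scalerAr tpureZl.
by rewrite mulrDr tpureDr -scalerAr tpureZr.
Qed.

Let bilin2 t : bilinear_for *:%R *:%R
  (fun (a : A) (c : C) => tlift (fun a' c' => (a * a') ⊙ (c * c')) t).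
Proof.
split=> [y b x x'|x b y y'] /=; rewrite -tlift_funP; apply: eq_tlift => u v /=.
  by rewrite mulrDl tpureDl -scalerAl tpureZl.
by rewrite mulrDl tpureDr -scalerAl tpureZr.
Qed.

Lemma tmul_pure a c a' c' : tmul (a ⊙ c) (a' ⊙ c') = (a * a') ⊙ (c * c').
Proof. by rewrite /tmul !tlift_pure. Qed.
Lemma tmul_linearl t : linear (tmul^~ t).
Proof. exact: tlift_linear. Qed.
Lemma tmul_linearr s : linear (tmul s).
Proof.
move=> b t t'; rewrite /tmul -tlift_funP; apply: eq_tlift => u v.
exact: tlift_linear.
Qed.

Lemma tmulDl : left_distributive tmul +%R.
Proof. by move=> s t r; have := tmul_linearl r 1 s t; rewrite !scale1r. Qed.
Lemma tmulDr : right_distributive tmul +%R.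
Proof. by move=> r s t; have := tmul_linearr r 1 s t; rewrite !scale1r. Qed.
Lemma tmul0l t : tmul 0 t = 0.
Proof. by apply: (addrI (tmul 0 t)); rewrite -tmulDl !addr0. Qed.
Lemma tmul0r t : tmul t 0 = 0.
Proof. by apply: (addrI (tmul t 0)); rewrite -tmulDr !addr0. Qed.

Lemma tmulA : associative tmul.
Proof.
move=> r s t; elim/tens_ind: r => [|a c r IH]; first by rewrite !tmul0l.
rewrite !tmulDl IH; congr (_ + _); clear r IH.
elim/tens_ind: s => [|a' c' s IH]; first by rewrite tmul0l !tmul0r tmul0l.
rewrite !(tmulDl, tmulDr) IH; congr (_ + _); clear s IH.
elim/tens_ind: t => [|a'' c'' t IH]; first by rewrite !tmul0r.
by rewrite !tmulDr IH !tmul_pure !mulrA.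
Qed.
Lemma tmul1 : left_id (1 ⊙ 1) tmul.
Proof.
elim/tens_ind=> [|a c t IH]; first by rewrite tmul0r.
by rewrite tmulDr IH tmul_pure !mul1r.
Qed.
Lemma tmulr1 : right_id (1 ⊙ 1) tmul.
Proof.
elim/tens_ind=> [|a c t IH]; first by rewrite tmul0l.
by rewrite tmulDl IH tmul_pure !mulr1.
Qed.
Lemma tone_neq0 : (1 : A) ⊙ (1 : C) != 0.
Proof. by apply: tpure_neq0; [apply: functional_ex|]; exact: oner_neq0. Qed.

HB.instance Definition _ := GRing.Zmodule_isNzRing.Build (A ⊗ C)
  tmulA tmul1 tmulr1 tmulDl tmulDr tone_neq0.
Lemma tscalerAl b (s t : A ⊗ C) : b *: (s * t) = (b *: s) * t.
Proof. by have := tmul_linearl t b s 0; rewrite !addr0 tmul0l addr0. Qed.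
Lemma tscalerAr b (s t : A ⊗ C) : b *: (s * t) = s * (b *: t).
Proof. by have := tmul_linearr s b t 0; rewrite !addr0 tmul0r addr0. Qed.
HB.instance Definition _ := GRing.Lmodule_isLalgebra.Build k (A ⊗ C) tscalerAl.
HB.instance Definition _ := GRing.Lalgebra_isAlgebra.Build k (A ⊗ C) tscalerAr.
End TensorAlgebra.

(* A differential graded algebra, as the total algebra of the direct sum of the
   degree n parts; [gpr n] is the projection onto the degree n part. *)
Record dga (k : fieldType) := Dga {
  dga_alg :> algType k;
  gpr : nat -> {linear dga_alg -> dga_alg};
  dif : {linear dga_alg -> dga_alg};
  gpr_gpr : forall m n w, gpr m (gpr n w) = if m == n then gpr n w else 0;
  gpr_sum : forall w, exists N, w = \sum_(i < N) gpr i w;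
  gpr1 : gpr 0 1 = 1;
  gprM : forall m n v w,
    gpr m v = v -> gpr n w = w -> gpr (m + n) (v * w) = v * w;
  gpr_dif : forall n w, gpr n w = w -> gpr n.+1 (dif w) = dif w;
  dif_dif : forall w, dif (dif w) = 0;
  difM : forall n v w, gpr n v = v ->
    dif (v * w) = dif v * w + (-1) ^+ n *: (v * dif w)
}.

Arguments gpr {k d} n.
Arguments dif {k d}.

Section DgaTheory.
Variables (k : fieldType) (D : dga k).
Implicit Types v w : D.

Definition homog (n : nat) : set D := [set w | gpr n w = w].

Lemma homog_gpr n w : homog n (gpr n w).
Proof. by rewrite /homog /= gpr_gpr eqxx. Qed.

Lemma gpr_homog m n w : homog n w -> gpr m w = if m == n then w else 0.
Proof. by move=> hw; rewrite -hw gpr_gpr hw. Qed.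

Lemma homog0 n : homog n 0. Proof. exact: linear0. Qed.
Lemma homogP n a v w : homog n v -> homog n w -> homog n (a *: v + w).
Proof. by move=> hv hw; rewrite /homog /= linearP hv hw. Qed.
Lemma homogD n v w : homog n v -> homog n w -> homog n (v + w).
Proof. by move=> hv hw; rewrite /homog /= linearD hv hw. Qed.
Lemma homogZ n a v : homog n v -> homog n (a *: v).
Proof. by move=> hv; rewrite /homog /= linearZ /= hv. Qed.

Lemma homog_ind (P : D -> Prop) :
  P 0 -> (forall n v w, homog n v -> P w -> P (v + w)) -> forall w, P w.
Proof.
move=> P0 PD w; have [N ->] := gpr_sum w.
elim/big_rec: _ => // i y _ Py.
by apply: PD Py; apply: homog_gpr.
Qed.

Fact gbound_ex w : exists N, w == \sum_(i < N) gpr i w.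
Proof. by have [N wN] := gpr_sum w; exists N; apply/eqP. Qed.
Definition gbound w := ex_minn (gbound_ex w).

(* The sum of F i over the homogeneous components w_i of w. *)
Definition gsum (V : lmodType k) (F : nat -> D -> V) w : V :=
  \sum_(i < gbound w) F i (gpr i w).

Lemma gpr_big N w : w = \sum_(i < N) gpr i w ->
  forall i, (N <= i)%N -> gpr i w = 0.
Proof.
move=> -> i Ni; rewrite linear_sum big1 // => j _.
by rewrite gpr_gpr gtn_eqF // (leq_trans (ltn_ord j)).
Qed.

Section Gsum.
Variables (V : lmodType k) (F : nat -> D -> V).
Hypothesis F_lin : forall i, linear (F i).

Let F0 i : F i 0 = 0.
Proof.
apply: (addrI (F i 0)); have := F_lin i 1 0 0.
by rewrite !scale1r !addr0 => <-.
Qed.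

Lemma gsum_widen N M w : w = \sum_(i < N) gpr i w -> (N <= M)%N ->
  \sum_(i < M) F i (gpr i w) = \sum_(i < N) F i (gpr i w).
Proof.
move=> wN NM.
rewrite -!(big_mkord xpredT (fun i => F i (gpr i w))) (big_cat_nat (leq0n N) NM) //=.
rewrite [X in _ + X]big_nat_cond [X in _ + X]big1 ?addr0 //.
by move=> i; rewrite andbT => /andP[Ni _]; rewrite (gpr_big wN).
Qed.

Lemma gsumE N w : w = \sum_(i < N) gpr i w ->
  gsum F w = \sum_(i < N) F i (gpr i w).
Proof.
move=> wN; rewrite /gsum /gbound; case: ex_minnP => M /eqP wM minM.
by rewrite -(@gsum_widen M N) //; apply: minM; rewrite -wN.
Qed.

Lemma gsum_homog n w : homog n w -> gsum F w = F n w.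
Proof.
move=> hw; rewrite (@gsumE n.+1).
  rewrite big_ord_recr /= big1 ?add0r ?hw // => i _.
  by rewrite (gpr_homog _ hw) ltn_eqF.
rewrite big_ord_recr /= big1 ?add0r ?hw // => i _.
by rewrite (gpr_homog _ hw) ltn_eqF.
Qed.

Lemma gpr_sum_widen N M w : w = \sum_(i < N) gpr i w -> (N <= M)%N ->
  w = \sum_(i < M) gpr i w.
Proof.
move=> wN NM; rewrite {1}wN.
rewrite -!(big_mkord xpredT (fun i => gpr i w)) [RHS](big_cat_nat (leq0n N) NM) //=.
rewrite [X in _ = _ + X]big_nat_cond [X in _ = _ + X]big1 ?addr0 //.
by move=> i; rewrite andbT => /andP[Ni _]; rewrite (gpr_big wN).
Qed.

Lemma gsum_linear : linear (gsum F).
Proof.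
move=> a v w; have [N vN] := gpr_sum v; have [M wM] := gpr_sum w.
have {}vN := gpr_sum_widen vN (leq_maxl N M).
have {}wM := gpr_sum_widen wM (leq_maxr N M).
rewrite (gsumE vN) (gsumE wM) (@gsumE (maxn N M)).
  rewrite scaler_sumr -big_split /=; apply: eq_bigr => i _.
  by rewrite linearP F_lin.
rewrite {1}vN {1}wM scaler_sumr -big_split /=; apply: eq_bigr => i _.
by rewrite linearP.
Qed.
End Gsum.

Lemma gsum_funP (V : lmodType k) a (F G : nat -> D -> V) w :
  gsum (fun i x => a *: F i x + G i x) w = a *: gsum F w + gsum G w.
Proof. by rewrite /gsum scaler_sumr -big_split. Qed.

Lemma eq_gsum (V : lmodType k) (F G : nat -> D -> V) :
  (forall i, F i =1 G i) -> gsum F =1 gsum G.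
Proof. by move=> FG w; apply: eq_bigr => i _; rewrite FG. Qed.

End DgaTheory.

Lemma gtens_ind (k : fieldType) (D E : dga k) (P : D ⊗ E -> Prop) :
  P 0 ->
  (forall p q u v t, homog p u -> homog q v -> P t -> P (u ⊙ v + t)) ->
  forall t, P t.
Proof.
move=> P0 PD; elim/tens_ind=> // u v t Pt.
elim/homog_ind: u v t Pt => [v t Pt|p u u' hu IHu v t Pt].
  by rewrite linear0l add0r.
rewrite tpureDl -addrA; move: (_ + t) (IHu v t Pt) => s Ps {u' IHu t Pt}.
elim/homog_ind: v s Ps => [s Ps|q v v' hv IHv s Ps].
  by rewrite linear0r add0r.
by rewrite tpureDr -addrA; exact: PD hu hv (IHv _ Ps).
Qed.

(* The carrier of the graded tensor product is D ⊗ E; it is given its own name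
   because its product has the Koszul sign, unlike that of D ⊗ E above. *)
Section GradedTensor.
Variables (k : fieldType) (D E : dga k).

Definition gtens : Type := D ⊗ E.
HB.instance Definition _ := GRing.Lmodule.on gtens.

Definition gtmul (s t : D ⊗ E) : D ⊗ E :=
  tlift (fun a b => tlift (fun a' b' =>
    gsum (fun q bq => gsum (fun p ap =>
      (-1) ^+ (q * p) *: ((a * ap) ⊙ (bq * b'))) a') b) t) s.

Let lin1 a b' q bq : forall p, linear (fun ap : D =>
  (-1) ^+ (q * p) *: ((a * ap) ⊙ (bq * b')) : D ⊗ E).
Proof.
move=> p c u v.
by rewrite mulrDr -scalerAr tpureDl tpureZl scalerDr !scalerA mulrC.
Qed.

Let lin2 a a' b' : forall q, linear (fun bq : E => gsum (fun p ap =>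
  (-1) ^+ (q * p) *: ((a * ap) ⊙ (bq * b'))) a' : D ⊗ E).
Proof.
move=> q c u v; rewrite -gsum_funP; apply: eq_gsum => p ap.
by rewrite mulrDl -scalerAl tpureDr tpureZr scalerDr !scalerA mulrC.
Qed.

Let bilin1 a b : bilinear_for *:%R *:%R (fun (a' : D) (b' : E) =>
    gsum (fun q bq => gsum (fun p ap =>
      (-1) ^+ (q * p) *: ((a * ap) ⊙ (bq * b'))) a') b : D ⊗ E).
Proof.
split=> [b' c u v|a' c u v] /=.
  rewrite -gsum_funP; apply: eq_gsum => q bq.
  by rewrite gsum_linear.
rewrite -gsum_funP; apply: eq_gsum => q bq.
rewrite -gsum_funP; apply: eq_gsum => p ap.
by rewrite mulrDr -scalerAr tpureDr tpureZr scalerDr !scalerA mulrC.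
Qed.

Let bilin2 t : bilinear_for *:%R *:%R (fun (a : D) (b : E) =>
  tlift (fun a' b' => gsum (fun q bq => gsum (fun p ap =>
      (-1) ^+ (q * p) *: ((a * ap) ⊙ (bq * b'))) a') b : D ⊗ E) t).
Proof.
split=> [b c u v|a c u v] /=; rewrite -tlift_funP; apply: eq_tlift => a' b'.
  rewrite -gsum_funP; apply: eq_gsum => q bq.
  rewrite -gsum_funP; apply: eq_gsum => p ap.
  by rewrite mulrDl -scalerAl tpureDl tpureZl scalerDr !scalerA mulrC.
by rewrite gsum_linear.
Qed.

Lemma gtmul_pure p q a b a' b' : homog q b -> homog p a' ->
  gtmul (a ⊙ b) (a' ⊙ b') = (-1) ^+ (q * p) *: ((a * a') ⊙ (b * b')).
Proof.
move=> hb ha'; rewrite /gtmul !tlift_pure // (gsum_homog _ hb) //.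
by rewrite (gsum_homog _ ha').
Qed.

Lemma gtmulDl : left_distributive gtmul +%R.
Proof.
move=> s t r; have := tlift_linear (bilin2 r) 1 s t.
by rewrite !scale1r.
Qed.
Lemma gtmul_linearr s : linear (gtmul s).
Proof.
move=> b t t'; rewrite /gtmul -tlift_funP; apply: eq_tlift => u v.
exact: tlift_linear.
Qed.
Lemma gtmulDr : right_distributive gtmul +%R.
Proof. by move=> r s t; have := gtmul_linearr r 1 s t; rewrite !scale1r. Qed.
Lemma gtmul0l t : gtmul 0 t = 0.
Proof. by apply: (addrI (gtmul 0 t)); rewrite -gtmulDl !addr0. Qed.
Lemma gtmul0r t : gtmul t 0 = 0.
Proof. by apply: (addrI (gtmul t 0)); rewrite -gtmulDr !addr0. Qed.
Lemma gtmulZl b s t : gtmul (b *: s) t = b *: gtmul s t.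
Proof.
have := tlift_linear (bilin2 t) b s 0.
by rewrite !addr0 -[tlift _ 0]/(gtmul 0 t) gtmul0l addr0.
Qed.
Lemma gtmulZr b s t : gtmul s (b *: t) = b *: gtmul s t.
Proof. by have := gtmul_linearr s b t 0; rewrite !addr0 gtmul0r addr0. Qed.

Lemma gtmulA : associative gtmul.
Proof.
move=> r s t; elim/gtens_ind: r => [|p q a b r ha hb IH].
  by rewrite !gtmul0l.
rewrite !gtmulDl IH; congr (_ + _); clear r IH.
elim/gtens_ind: s => [|p' q' a' b' s ha' hb' IH].
  by rewrite gtmul0l !gtmul0r gtmul0l.
rewrite !(gtmulDl, gtmulDr) IH; congr (_ + _); clear s IH.
elim/gtens_ind: t => [|p'' q'' a'' b'' t ha'' hb'' IH].
  by rewrite !gtmul0r.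
rewrite !gtmulDr IH; congr (_ + _); clear t IH.
rewrite (gtmul_pure _ _ hb' ha'') (gtmul_pure _ _ hb ha') gtmulZr gtmulZl.
rewrite (gtmul_pure _ _ hb (gprM ha' ha'')) (gtmul_pure _ _ (gprM hb hb') ha'').
by rewrite !scalerA !mulrA -!exprD mulnDr mulnDl addnCA [(q' * p'' + _)%N]addnC.
Qed.

Lemma gtmul1l : left_id (1 ⊙ 1) gtmul.
Proof.
elim/gtens_ind=> [|p q a b t ha hb IH]; first by rewrite gtmul0r.
by rewrite gtmulDr IH (gtmul_pure _ _ (gpr1 E) ha) !mul1r scale1r.
Qed.
Lemma gtmulr1 : right_id (1 ⊙ 1) gtmul.
Proof.
elim/gtens_ind=> [|p q a b t ha hb IH]; first by rewrite gtmul0l.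
by rewrite gtmulDl IH (gtmul_pure _ _ hb (gpr1 D)) !mulr1 muln0 scale1r.
Qed.

HB.instance Definition _ := GRing.Zmodule_isNzRing.Build gtens
  gtmulA gtmul1l gtmulr1 gtmulDl gtmulDr (tone_neq0 D E).
Lemma gtscalerAl b (s t : gtens) : b *: (s * t : gtens) = (b *: s : gtens) * t :> gtens.
Proof. exact: (esym (gtmulZl b s t)). Qed.
Lemma gtscalerAr b (s t : gtens) : b *: (s * t : gtens) = s * (b *: t : gtens) :> gtens.
Proof. exact: (esym (gtmulZr b s t)). Qed.
HB.instance Definition _ := GRing.Lmodule_isLalgebra.Build k gtens gtscalerAl.
HB.instance Definition _ := GRing.Lalgebra_isAlgebra.Build k gtens gtscalerAr.

Definition gtpr (n : nat) (t : gtens) : gtens :=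
  \sum_(p < n.+1) tmap (gpr p) (gpr (n - p)) t.

Lemma gtpr_linear n : linear (gtpr n).
Proof.
move=> a s t; rewrite /gtpr scaler_sumr -big_split /=.
by apply: eq_bigr => p _; rewrite linearP.
Qed.
HB.instance Definition _ n :=
  GRing.isLinear.Build k gtens gtens *:%R (gtpr n) (gtpr_linear n).

Lemma gtpr_pure n p q u v : homog p u -> homog q v ->
  gtpr n (u ⊙ v) = if n == (p + q)%N then u ⊙ v else 0.
Proof.
move=> hu hv; rewrite /gtpr.
under eq_bigr => i _ do rewrite tmap_pure (gpr_homog _ hu) (gpr_homog _ hv).
have [->|npq] := eqVneq.
  rewrite (bigD1 (inord p)) //= inordK ?eqxx ?addKn ?eqxx; last first.
    by rewrite ltnS leq_addr.
  rewrite big1 ?addr0 // => i ip; rewrite ifN ?linear0l //.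
  apply: contra ip => /eqP ip; apply/eqP/val_inj => /=.
  by rewrite inordK // ltnS leq_addr.
rewrite big1 // => i _; case: eqVneq => [ip|]; last by rewrite linear0l.
case: eqVneq => [iq|]; last by rewrite linear0r.
by move: npq; rewrite -ip -iq subnKC ?eqxx // -ltnS.
Qed.

Definition gtdif : gtens -> gtens :=
  tlift (fun a b => gsum (fun p ap =>
    dif ap ⊙ b + (-1) ^+ p *: (ap ⊙ dif b)) a).

Let lin3 b : forall p, linear (fun ap : D =>
  dif ap ⊙ b + (-1) ^+ p *: (ap ⊙ dif b) : D ⊗ E).
Proof.
move=> p c u v.
rewrite linearP /= !tpureDl !tpureZl !scalerDr !scalerA [c * _]mulrC.
by rewrite addrACA.
Qed.

Let bilin3 : bilinear_for *:%R *:%R (fun (a : D) (b : E) =>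
  gsum (fun p ap => dif ap ⊙ b + (-1) ^+ p *: (ap ⊙ dif b)) a : D ⊗ E).
Proof.
split=> [b c u v|a c u v] /=; first by rewrite gsum_linear.
rewrite -gsum_funP; apply: eq_gsum => p ap.
rewrite linearP /= !tpureDr !tpureZr !scalerDr !scalerA [c * _]mulrC.
by rewrite addrACA.
Qed.

Lemma gtdif_pure p a b : homog p a ->
  gtdif (a ⊙ b) = dif a ⊙ b + (-1) ^+ p *: (a ⊙ dif b).
Proof. by move=> ha; rewrite /gtdif tlift_pure // (gsum_homog _ ha). Qed.
Lemma gtdif_linear : linear gtdif.
Proof. exact: tlift_linear. Qed.
HB.instance Definition _ :=
  GRing.isLinear.Build k gtens gtens *:%R gtdif gtdif_linear.

Lemma gtpr_gtpr m n t : gtpr m (gtpr n t) = if m == n then gtpr n t else 0.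
Proof.
elim/gtens_ind: t => [|p q a b t ha hb IH]; first by rewrite !linear0 if_same.
rewrite !linearD /= IH (gtpr_pure _ ha hb).
have [->|npq] := eqVneq n.
  by rewrite (gtpr_pure _ ha hb); case: eqVneq => //; rewrite addr0.
by rewrite linear0 !add0r.
Qed.

Lemma gtpr_sum t : exists N, t = \sum_(i < N) gtpr i t.
Proof.
suff [N tN] : exists N, forall M, (N <= M)%N -> t = \sum_(i < M) gtpr i t.
  by exists N; apply: tN.
elim/gtens_ind: t => [|p q a b t ha hb [N IH]].
  by exists 0%N => M _; rewrite big1 // => i _; rewrite linear0.
exists (maxn N (p + q).+1) => M; rewrite geq_max => /andP[NM pqM].
under eq_bigr => i _ do rewrite linearD /= (gtpr_pure _ ha hb).
rewrite big_split /= -IH //; congr (_ + _).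
rewrite (bigD1 (Ordinal pqM)) //= eqxx big1 ?addr0 // => i.
by rewrite -val_eqE /= => /negbTE ->.
Qed.

Lemma gtpr1 : gtpr 0 1 = 1.
Proof. by rewrite [LHS](gtpr_pure _ (gpr1 D) (gpr1 E)) addn0 eqxx. Qed.

Lemma gtens_homog_ind n (P : gtens -> Prop) :
  P 0 ->
  (forall p q u v t, (p + q)%N = n -> homog p u -> homog q v -> P t ->
     P (u ⊙ v + t)) ->
  forall t, gtpr n t = t -> P t.
Proof.
move=> P0 PD t <-; elim/gtens_ind: t => [|p q u v t hu hv IH].
  by rewrite linear0.
rewrite linearD /= (gtpr_pure _ hu hv).
by have [npq|] := eqVneq n; [apply: (PD p q) => //|rewrite add0r].
Qed.

Lemma gtprM m n (s t : gtens) : gtpr m s = s -> gtpr n t = t ->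
  gtpr (m + n) (s * t) = s * t.
Proof.
move=> hs ht; elim/gtens_homog_ind: s / hs => [|p q a b s <- ha hb IH].
  by rewrite mul0r linear0.
rewrite mulrDl linearD /= IH; congr (_ + _); clear s IH.
elim/gtens_homog_ind: t / ht => [|p' q' a' b' t <- ha' hb' IH].
  by rewrite mulr0 linear0.
rewrite mulrDr linearD /= IH; congr (_ + _); clear t IH.
rewrite [_ * _](gtmul_pure _ _ hb ha') linearZ /=.
by rewrite (gtpr_pure _ (gprM ha ha') (gprM hb hb')) addnACA eqxx.
Qed.

Lemma gtpr_dif n t : gtpr n t = t -> gtpr n.+1 (gtdif t) = gtdif t.
Proof.
move=> ht; elim/gtens_homog_ind: t / ht => [|p q a b t <- ha hb IH].
  by rewrite !linear0.
rewrite !linearD /= IH (gtdif_pure _ ha); congr (_ + _).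
rewrite linearD linearZ /= (gtpr_pure _ (gpr_dif ha) hb) addSn eqxx.
by rewrite (gtpr_pure _ ha (gpr_dif hb)) addnS eqxx.
Qed.

Lemma gtdif_dif t : gtdif (gtdif t) = 0.
Proof.
elim/gtens_ind: t => [|p q a b t ha hb IH]; first by rewrite !linear0.
rewrite !linearD /= IH addr0 (gtdif_pure _ ha) linearD linearZ /=.
rewrite (gtdif_pure _ (gpr_dif ha)) (gtdif_pure _ ha) !dif_dif.
rewrite linear0l linear0r add0r ?scaler0 ?addr0 exprS mulN1r scaleNr.
by rewrite addNr.
Qed.

Lemma gtdif_gtmul_pure p q p' q' a b a' b' :
  homog p a -> homog q b -> homog p' a' -> homog q' b' ->
  gtdif (gtmul (a ⊙ b) (a' ⊙ b')) =
  gtmul (gtdif (a ⊙ b)) (a' ⊙ b') +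
  (-1) ^+ (p + q) *: gtmul (a ⊙ b) (gtdif (a' ⊙ b')) :> D ⊗ E.
Proof.
move=> ha hb ha' hb'.
rewrite (gtmul_pure _ _ hb ha') linearZ /=.
rewrite (gtdif_pure _ (gprM ha ha')) (gtdif_pure _ ha) (gtdif_pure _ ha').
rewrite gtmulDl gtmulDr gtmulZl gtmulZr.
rewrite (gtmul_pure _ _ hb ha') (gtmul_pure _ _ (gpr_dif hb) ha').
rewrite (gtmul_pure _ _ hb (gpr_dif ha')) (gtmul_pure _ _ hb ha').
rewrite (difM _ ha) (difM _ hb) tpureDl tpureDr tpureZl tpureZr.
rewrite !scalerDr !scalerA -!exprD [LHS]addrACA.
have sgn m n (x : D ⊗ E) : odd m = odd n -> (-1) ^+ m *: x = (-1) ^+ n *: x.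
  by move=> mn; rewrite -(signr_odd _ m) mn signr_odd.
congr (_ + _ + (_ + _)); apply: sgn;
by rewrite !(oddD, oddM, oddS) /=; do 4!case: odd.
Qed.

Lemma gtdifM n (s t : gtens) : gtpr n s = s ->
  gtdif (s * t) = (gtdif s * t : gtens) + (-1) ^+ n *: (s * gtdif t : gtens)
  :> gtens.
Proof.
move=> hs; elim/gtens_homog_ind: s / hs => [|p q a b s <- ha hb IH].
  by rewrite linear0 !mul0r linear0 scaler0 addr0.
rewrite mulrDl !linearD /= IH mulrDl [in RHS]mulrDl scalerDr addrACA.
congr (_ + _); clear s IH.
elim/gtens_ind: t => [|p' q' a' b' t ha' hb' IH].
  by rewrite mulr0 linear0 !mulr0 scaler0 addr0.
rewrite mulrDr !linearD /= mulrDr IH mulrDr scalerDr addrACA.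
congr (_ + _); clear t IH.
have H := gtdif_gtmul_pure ha hb ha' hb'. exact: H.
Qed.

Definition dga_tens : dga k :=
  Dga gtpr_gtpr gtpr_sum gtpr1 gtprM gtpr_dif gtdif_dif gtdifM.
End GradedTensor.
Record dgmap (k : fieldType) (D E : dga k) := DgMap {
  dgmap_fun :> {lrmorphism D -> E};
  dgmap_gpr : forall n w, dgmap_fun (gpr n w) = gpr n (dgmap_fun w);
  dgmap_dif : forall w, dgmap_fun (dif w) = dif (dgmap_fun w)
}.

(* [cin] and [cpr] identify A with the degree 0 part of [forms]; [density] is
   the inclusion of the (n+1)-forms in A.d(n-forms). *)
Record calculus (k : fieldType) (A : algType k) := Calculus {
  forms :> dga k;
  cin : {lrmorphism A -> forms};
  cpr : {linear forms -> A};
  cinK : cancel cin cpr;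
  cprK : forall w, cin (cpr w) = gpr 0 w;
  density : forall n w, homog n.+1 w -> w \in lspan
    [set v | exists a, exists2 u, homog n u & v = cin a * dif u]
}.
Arguments cin {k A c}.
Arguments cpr {k A c}.

(* f is differentiable iff it has such an extension F, which is then unique
   ([extends_uniq]). *)
Definition extends (k : fieldType) (A C : algType k)
    (OA : calculus A) (OC : calculus C) (f : A -> C) (F : dgmap OA OC) :=
  forall a, F (cin a) = cin (f a).

Lemma homog_cin (k : fieldType) (A : algType k) (O : calculus A) a :
  homog 0 (cin a : O).
Proof. by rewrite /homog /= -cprK cinK. Qed.

Lemma cin_cpr (k : fieldType) (A : algType k) (O : calculus A) (w : O) :
  homog 0 w -> cin (cpr w) = w.
Proof. by rewrite cprK. Qed.

Lemma dif1 (k : fieldType) (D : dga k) : dif (1 : D) = 0.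
Proof.
have := difM 1 (gpr1 D); rewrite !mul1r mulr1 expr0 scale1r => /eqP.
by rewrite -subr_eq0 opprD addNKr oppr_eq0 => /eqP.
Qed.

Lemma extends_uniq (k : fieldType) (A C : algType k)
    (OA : calculus A) (OC : calculus C) (f : A -> C) (F G : dgmap OA OC) :
  extends f F -> extends f G -> F =1 G.
Proof.
move=> Ff Gf; have FG n w : homog n w -> F w = G w.
  elim: n w => [|n IH] w hw; first by rewrite -(cin_cpr hw) Ff Gf.
  have /lspanP[s sA ->] := density hw.
  rewrite !linear_sum big_seq [RHS]big_seq; apply: eq_bigr => p /sA[a [u hu ->]].
  by rewrite !linearZ /= !rmorphM /= Ff Gf !dgmap_dif IH.
elim/homog_ind => [|n v w hv IH]; first by rewrite !linear0.
by rewrite !linearD /= IH; congr (_ + _); exact: FG hv.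
Qed.

Section CalculusTensor.
Variables (k : fieldType) (A C : algType k) (OA : calculus A) (OC : calculus C).
Local Notation OAC := (dga_tens OA OC).

Definition ctin (t : A ⊗ C) : OAC := tmap cin cin t.
Definition ctpr (w : OAC) : A ⊗ C := tmap cpr cpr w.

Lemma ctin_linear : linear ctin.
Proof. exact: tmap_linear. Qed.
Lemma ctpr_linear : linear ctpr.
Proof. exact: tmap_linear. Qed.
HB.instance Definition _ :=
  GRing.isLinear.Build k (A ⊗ C) OAC *:%R ctin ctin_linear.
HB.instance Definition _ :=
  GRing.isLinear.Build k OAC (A ⊗ C) *:%R ctpr ctpr_linear.

Lemma ctin_monoid : monoid_morphism ctin.
Proof.
split; first by rewrite /ctin [LHS]tmap_pure !rmorph1.
move=> s t; rewrite -[RHS]/(gtmul _ _).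
elim/tens_ind: s => [|a c s IH]; first by rewrite mul0r linear0 gtmul0l.
rewrite mulrDl !linearD /= IH gtmulDl; congr (_ + _); clear s IH.
elim/tens_ind: t => [|a' c' t IH]; first by rewrite mulr0 linear0 gtmul0r.
rewrite mulrDr !linearD /= IH gtmulDr; congr (_ + _); clear t IH.
rewrite -[_ * _]/(tmul _ _) tmul_pure /ctin !tmap_pure.
by rewrite (gtmul_pure _ _ (homog_cin _ _) (homog_cin _ _)) scale1r !rmorphM.
Qed.
HB.instance Definition _ :=
  GRing.isMonoidMorphism.Build (A ⊗ C) OAC ctin ctin_monoid.

Lemma ctinK : cancel ctin ctpr.
Proof.
elim/tens_ind=> [|a c t IH]; first by rewrite !linear0.
by rewrite !linearD /= IH /ctin /ctpr !tmap_pure /= !cinK.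
Qed.

Lemma ctprK w : ctin (ctpr w) = gpr 0 w.
Proof.
rewrite -[RHS]/(gtpr 0 w) /gtpr big_ord1 subn0.
elim/tens_ind: w => [|a c t IH]; first by rewrite !linear0.
by rewrite !linearD /= IH /ctin /ctpr !tmap_pure /= !cprK.
Qed.

Let dens n : set OAC :=
  [set v | exists a, exists2 u, homog n u & v = ctin a * dif u].

Let dens_mul n a w : w \in lspan (dens n) -> ctin a * w \in lspan (dens n).
Proof.
move=> /lspanP[s sA ->]; rewrite mulr_sumr big_seq; apply: rpred_sum => p /sA.
move=> [b [u hu ->]]; rewrite -scalerAr; apply: rpredZ; apply: mem_lspan.
by exists (a * b); exists u => //; rewrite mulrA rmorphM.
Qed.

Let pure_dens p q (u : OA) (v : OC) n : homog p u -> homog q v ->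
  (p + q)%N = n.+1 -> (u ⊙ v : OAC) \in lspan (dens n).
Proof.
elim: p q u v => [|p IH] q u v hu hv pq.
  case: q pq hv => // q [<-] hv; have /lspanP[s sA ->] := density hv.
  rewrite linear_sumr /= big_seq; apply: rpred_sum => -[a w] /sA[c [w' hw' /= ->]].
  rewrite tpureZr; apply: rpredZ; apply: mem_lspan.
  exists (cpr u ⊙ c); exists (1 ⊙ w').
    by rewrite /homog /= [LHS](gtpr_pure _ (gpr1 _) hw') eqxx.
  rewrite -[RHS]/(gtmul _ (gtdif _)) (gtdif_pure _ (gpr1 _)) dif1 linear0l.
  rewrite add0r scale1r /ctin tmap_pure /= cin_cpr //.
  by rewrite (gtmul_pure _ _ (homog_cin _ _) (gpr1 _)) muln0 scale1r mulr1.
have /lspanP[s sA ->] := density hu.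
rewrite linear_sumlz /= big_seq; apply: rpred_sum => -[a w] /sA[c [w' hw' /= ->]].
rewrite tpureZl; apply: rpredZ.
have -> : (cin c * dif w') ⊙ v = ctin (c ⊙ 1) * dif (w' ⊙ v : OAC)
   - (-1) ^+ p *: ((cin c * w') ⊙ dif v) :> OAC.
  rewrite -[ctin _ * _]/(gtmul _ (gtdif _)) (gtdif_pure _ hw') gtmulDr gtmulZr.
  rewrite /ctin tmap_pure /= rmorph1.
  rewrite (gtmul_pure _ _ (gpr1 _) (gpr_dif hw')).
  by rewrite (gtmul_pure _ _ (gpr1 _) hw') !scale1r !mul1r addrK.
apply: rpredB.
  apply: mem_lspan; exists (c ⊙ 1); exists (w' ⊙ v) => //.
  by move: pq => [<-]; rewrite /homog /= [LHS](gtpr_pure _ hw' hv) eqxx.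
apply: rpredZ; apply: (IH q.+1); first exact: gprM (homog_cin _ _) hw'.
  exact: gpr_dif.
by rewrite addnS -addSn.
Qed.

Lemma ct_density n w : homog n.+1 w -> w \in lspan (dens n).
Proof.
move=> hw; elim/gtens_homog_ind: w / hw => [|p q u v t pq hu hv IH].
  exact: rpred0.
by apply: rpredD => //; apply: (pure_dens hu hv).
Qed.

Definition calc_tens : calculus (A ⊗ C) :=
  @Calculus k (A ⊗ C) OAC ctin ctpr ctinK ctprK ct_density.
End CalculusTensor.

Record hopf (k : fieldType) := Hopf {
  hopf_alg :> algType k;
  Delta : {lrmorphism hopf_alg -> hopf_alg ⊗ hopf_alg};
  counit : {lrmorphism hopf_alg -> k^o};
  antipode : {linear hopf_alg -> hopf_alg};
  antipodeV : {linear hopf_alg -> hopf_alg};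
  coassoc : forall x,
    tassoc (tmap Delta idfun (Delta x)) = tmap idfun Delta (Delta x);
  counitl : forall x, tlift (fun y z => counit y *: z) (Delta x) = x;
  counitr : forall x, tlift (fun y z => counit z *: y) (Delta x) = x;
  antipodel : forall x,
    tlift (fun y z => antipode y * z) (Delta x) = (counit x)%:A;
  antipoder : forall x,
    tlift (fun y z => y * antipode z) (Delta x) = (counit x)%:A;
  antipodeK : cancel antipode antipodeV;
  antipodeVK : cancel antipodeV antipode
}.
Arguments Delta {k h}.
Arguments counit {k h}.
Arguments antipode {k h}.
Arguments antipodeV {k h}.

(* Bicovariance is differentiability of the coproduct. *)
Record bicov (k : fieldType) (X : hopf k) := Bicov {
  bicov_calc :> calculus X;
  Delta_s : dgmap bicov_calc (calc_tens bicov_calc bicov_calc);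
  Delta_sE : extends Delta Delta_s
}.
Arguments Delta_s {k X b}.

Fixpoint tpow (k : fieldType) (V : lmodType k) (n : nat) : lmodType k :=
  if n is m.+1 then V ⊗ tpow V m else k^o.

Fixpoint tpows (k : fieldType) (V : lmodType k) (n : nat) :
    ('I_n -> V) -> tpow V n :=
  match n return ('I_n -> V) -> tpow V n with
  | 0 => fun=> (1 : k)
  | m.+1 => fun v => v ord0 ⊙ tpows (fun i => v (fintype.lift ord0 i))
  end.

Section Woronowicz.
Variables (k : fieldType) (X : hopf k) (O : bicov X).

(* On n-forms, these are the components of [Delta_s] in X ⊗ Ω^n and Ω^n ⊗ X,
   since [cpr] vanishes in nonzero degree. *)
Definition lcoact (w : O) : X ⊗ O := tmap cpr idfun (Delta_s w).
Definition rcoact (w : O) : O ⊗ X := tmap idfun cpr (Delta_s w).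

Definition linv : {pred O} :=
  fun w => `[< homog 1 w /\ lcoact w = 1 ⊙ w >].

Lemma lcoact_linear : linear lcoact.
Proof. by move=> a u v; rewrite /lcoact linearP; exact: tmap_linear. Qed.

Lemma linv_submod : subsemimod_closed linv.
Proof.
have lc0 : lcoact 0 = 0.
  have := lcoact_linear 1 0 0; rewrite !scale1r !addr0.
  by move/(congr1 (fun t => t - lcoact 0)); rewrite addrK subrr.
split; first split.
- by apply/asboolP; rewrite lc0 linear0r; split=> //; exact: homog0.
- move=> u v /asboolP[hu lu] /asboolP[hv lv]; apply/asboolP.
  split; first exact: homogD.
  by have := lcoact_linear 1 u v; rewrite !scale1r lu lv tpureDr.
- move=> a u /asboolP[hu lu]; apply/asboolP; split; first exact: homogZ.
  by have := lcoact_linear a u 0; rewrite lc0 !addr0 lu tpureZr.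
Qed.
HB.instance Definition _ := GRing.isSubmodClosed.Build k O linv linv_submod.

Record L1 := MkL1 { L1val : O; L1valP : L1val \in linv }.
HB.instance Definition _ := [isSub for L1val].
HB.instance Definition _ := [Choice of L1 by <:].
HB.instance Definition _ := [SubChoice_isSubLmodule of L1 by <:].

Definition lact (x : X) (w : O) : O :=
  tlift (fun x1 x2 => cin x2 * w * cin (antipodeV x1)) (Delta x).

(* The braiding is given by a formula that makes sense on all of O ⊗ O; below it
   is only used on the image of L1 ⊗ L1, which embeds in O ⊗ O. *)
Definition braid : O ⊗ O -> O ⊗ O :=
  tlift (fun xi eta =>
    tlift (fun eta0 eta1 => eta0 ⊙ lact (antipode eta1) xi) (rcoact eta)).

(* The tensors that lie in ker (braid - id) in two adjacent factors. *)
Inductive braid_rel : forall n, set (tpow L1 n) :=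
| BraidHead n (r : L1 ⊗ L1) (t : tpow L1 n) :
    braid (tmap val val r) = tmap val val r ->
    @braid_rel n.+2 (tassoc (r ⊙ t))
| BraidTail n (xi : L1) (t : tpow L1 n) :
    braid_rel t -> @braid_rel n.+1 (xi ⊙ t).

(* (L1)^{∧n} *)
Definition extpow (n : nat) : lmodType k := qmod (@braid_rel n).

Fixpoint mulpow (n : nat) : tpow L1 n -> O :=
  match n return tpow L1 n -> O with
  | 0 => fun a : k => a%:A
  | m.+1 => tlift (fun xi t => val xi * @mulpow m t)
  end.

Definition formmul (n : nat) : extpow n ⊗ X -> O :=
  tlift (fun xi x => qlift (@mulpow n) xi * cin x).

(* ξ ⊗ x |-> ξ x is a well-defined bijection from (L1)^{∧n} ⊗ X onto the
   n-forms.  The formula for the wedge product of two elements of this form is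
   a consequence, as the product of [O] is that of its calculus. *)
Definition woronowicz : Prop :=
  (forall n t, @braid_rel n t -> mulpow t = 0) /\
  (forall n, injective (@formmul n) /\ range (@formmul n) = homog n).

End Woronowicz.
Arguments formmul {k X} O n.

Definition hopf_map (k : fieldType) (X H : hopf k) (pi : {lrmorphism X -> H}) :=
  (forall x, Delta (pi x) = tmap pi pi (Delta x)) /\
  (forall x, counit (pi x) = counit x).

Definition left_integral (k : fieldType) (H : hopf k) (I : {linear H -> k^o}) :=
  (forall h, tlift (fun h1 h2 => I h2 *: h1) (Delta h) = (I h)%:A) /\ I 1 = 1.

(* Diagonal coaction on a tensor product of right comodules. *)
Definition tcoact (k : fieldType) (H : hopf k) (U V : lmodType k)
    (a : U -> U ⊗ H) (b : V -> V ⊗ H) : U ⊗ V -> (U ⊗ V) ⊗ H :=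
  tlift (fun u v => tlift (fun u0 u1 => tlift (fun v0 v1 =>
    (u0 ⊙ v0) ⊙ (u1 * v1)) (b v)) (a u)).

Definition coinv (k : fieldType) (H : hopf k) (V : lmodType k)
    (a : V -> V ⊗ H) : set V := [set v | a v = v ⊙ 1].

Definition surjective (T U : Type) (f : T -> U) := forall u, exists t, f t = u.

Section Base.
Variables (k : fieldType) (X H : hopf k) (OX : bicov X) (OH : bicov H).
Variables (pi : {lrmorphism X -> H}) (pis : dgmap OX OH).

Definition rho (x : X) : X ⊗ H := tmap idfun pi (Delta x).
Definition base : set X := coinv rho.

Definition baseforms1 : set OX :=
  [set` lspan [set w | exists b c, [/\ base b, base c & w = cin b * dif (cin c)]]].
Definition baseforms (n : nat) : set OX :=
  [set` lspan [set w | exists2 v : 'I_n -> OX,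
    (forall i, baseforms1 (v i)) & w = \prod_(i < n) v i]].

Definition Kforms : set (L1 OX) := [set xi | pis (val xi) = 0].

Definition condK : Prop := forall xi, Kforms xi ->
  val xi \in lspan [set w | exists b x, base b /\ w = dif (cin b) * cin x].

(* The coaction ξ |-> ξ_[0] ⊗ π(ξ_[1]), corestricted to L1 ⊗ H: L1 ⊗ H embeds in
   OX ⊗ H and contains the value, so that t exists and is unique. *)
Definition coactL (xi : L1 OX) : L1 OX ⊗ H :=
  xget 0 [set t | tmap val idfun t = tmap idfun pi (rcoact (val xi))].

Fixpoint coactpow (n : nat) : tpow (L1 OX) n -> tpow (L1 OX) n ⊗ H :=
  match n return tpow (L1 OX) n -> tpow (L1 OX) n ⊗ H with
  | 0 => fun a => a ⊙ 1
  | m.+1 => tcoact coactL (@coactpow m)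
  end.

Definition coactext (n : nat) : extpow OX n -> extpow OX n ⊗ H :=
  qlift (fun t => tmap (qproj _) idfun (coactpow t)).

Definition coactextX (n : nat) :
    extpow OX n ⊗ X -> (extpow OX n ⊗ X) ⊗ H :=
  tcoact (@coactext n) rho.

(* K^{∧n} inside (L1)^{∧n}, and K^{∧n} ⊗ X inside (L1)^{∧n} ⊗ X. *)
Definition Kext (n : nat) : set (extpow OX n) :=
  [set` lspan [set q | exists2 v : 'I_n -> L1 OX,
     (forall i, Kforms (v i)) & q = qproj _ (tpows v)]].

Definition KextX (n : nat) : set (extpow OX n ⊗ X) :=
  [set` lspan [set t | exists q x, @Kext n q /\ t = q ⊙ x]].
End Base.

Arguments baseforms {k X H} OX pi n.
Arguments KextX {k X H OX OH} pis n.
Arguments coactextX {k X H} OX pi n.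

(* Main.v *)
From HB Require Import structures.
Require Import Defs.
From mathcomp Require Import all_boot all_algebra.
From mathcomp Require Import boolp classical_sets.

Set Implicit Arguments.
Unset Strict Implicit.
Unset Printing Implicit Defensive.

Import GRing.Theory.
Local Open Scope ring_scope.
Local Open Scope classical_set_scope.

(** Write Ω for the forms on X, R for the right H-coaction
    w |-> w_[0] ⊗ π(w_[1]) on Ω ([hcoact]), and M_n for the span of the products
    ξ_1 ... ξ_n x with ξ_i in K and x in X ([kforms]), which is the image of
    K^{∧n} ⊗ X in Ω.  The theorem says that Ω^n B is the space of R-coinvariants of M_n.

    _Transport of coactions._  R is an algebra map, and on L^1 it is the given
    coaction of L^1 because the left and right coactions on Ω commute
    ([hcoact_lcoact]).  Hence ξ ⊗ x |-> ξ x intertwines the tensor product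
    coaction of (L^1)^{∧n} ⊗ X with R ([hcoact_formmul]); since it is injective,
    coinvariance can be tested in Ω ([coinv_formmul]).

    _Ω^n B lies in M_n and is coinvariant._  Coinvariance holds since R is
    multiplicative and commutes with d.  For the inclusion in M_n, consider
    T(w) = w_[-1] ⊗ π_*(w_[0]) ([vertical]), again an algebra map.  The key point is that
    M_1 is exactly the kernel of T on 1-forms ([kforms1P]): T(ξ x) =
    x_(1) ⊗ π_*(ξ) π(x_(2)), and Ω^1 H ≅ L^1 H ⊗ H lets one read π_*(ξ) ⊗ x off
    this.  A kernel of an algebra map absorbs X on both sides, so that
    M_1 M_n ⊂ M_{n+1} without computing with the action ▷; and T(db) =
    (id ⊗ d)(b ⊗ 1) = 0 for b in B, so that dB ⊂ M_1.

    _Coinvariants of M_n are in Ω^n B._  Condition K gives K ⊂ dB.X, and as M_n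
    absorbs X on the left, M_{n+1} = K M_n ⊂ dB M_n; so every element of M_n is
    a sum of terms ω x with ω a product of n elements of dB
    ([kforms_dbforms]).  The integral yields the projection
    E(w) = w_[0] ∫ w_[1] onto coinvariants, and E(ω x) = ω E(x) with E(x) in B.
    So a coinvariant w = E(w) in M_n is a sum of terms ω b with b in B, and
    db'.b = d(b'b) - b'.db is in Ω^1 B ([dbforms_coinv]). *)

(** * Spans *)

Lemma lspan_map (k : fieldType) (V W : lmodType k) (f : {linear V -> W})
    (A : set V) (S : submodClosed W) :
  (forall v, A v -> f v \in S) -> forall v, v \in lspan A -> f v \in S.
Proof.
move=> AS v /lspanP[s As ->]; rewrite linear_sum big_seq.
by apply: rpred_sum => p /As /AS Sp; rewrite linearZ rpredZ.
Qed.

Lemma lspan_lift (k : fieldType) (V W : lmodType k) (f : {linear V -> W})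
    (A : set V) (B : set W) :
  (forall w, B w -> exists2 v, v \in lspan A & f v = w) ->
  forall w, w \in lspan B -> exists2 v, v \in lspan A & f v = w.
Proof.
move=> BA w /lspanP[s]; elim: s w => [|p s IH] w Bs ->.
  by exists 0; rewrite ?rpred0 // linear0 big_nil.
have [|v Av fv] := IH _ _ erefl; first by move=> q qs; apply: Bs; rewrite inE qs orbT.
have [|u Au fu] := BA p.2; first by apply: Bs; rewrite inE eqxx.
exists (p.1 *: u + v); first by rewrite rpredD ?rpredZ.
by rewrite linearP fv fu big_cons.
Qed.

Section SpanMul.
Variables (k : fieldType) (C : algType k) (A : set C) (S : submodClosed C).

Lemma lspan_mull u : (forall v, A v -> u * v \in S) ->
  forall v, v \in lspan A -> u * v \in S.
Proof.
move=> AS v /lspanP[s As ->]; rewrite mulr_sumr big_seq.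
by apply: rpred_sum => p /As /AS Sp; rewrite -scalerAr rpredZ.
Qed.

Lemma lspan_mulr u : (forall v, A v -> v * u \in S) ->
  forall v, v \in lspan A -> v * u \in S.
Proof.
move=> AS v /lspanP[s As ->]; rewrite mulr_suml big_seq.
by apply: rpred_sum => p /As /AS Sp; rewrite -scalerAl rpredZ.
Qed.
End SpanMul.

(** * Tensor products over a field *)

(* Instances of linearity with a fixed head symbol, used as rewriting rules. *)
Section TensLinear.
Variables (k : fieldType) (U V U' V' W : lmodType k).

Lemma tmap0 (f : {linear U -> U'}) (g : {linear V -> V'}) : tmap f g 0 = 0.
Proof. exact: linear0. Qed.
Lemma tmapD (f : {linear U -> U'}) (g : {linear V -> V'}) s t :
  tmap f g (s + t) = tmap f g s + tmap f g t.
Proof. exact: linearD. Qed.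
Lemma tpure0l (v : V) : (0 : U) ⊙ v = 0.
Proof. exact: linear0l. Qed.
Lemma tpure0r (u : U) : u ⊙ (0 : V) = 0.
Proof. exact: linear0r. Qed.
Lemma tassoc0 : @tassoc k U V W 0 = 0.
Proof. exact: linear0. Qed.
Lemma tassocD (s t : (U ⊗ V) ⊗ W) : tassoc (s + t) = tassoc s + tassoc t.
Proof. exact: linearD. Qed.
End TensLinear.

Section Slice.
Variables (k : fieldType) (U W : lmodType k).
Implicit Types (phi : {linear W -> k^o}) (t : U ⊗ W).

Definition slice phi t : U := tlift (fun u w => phi w *: u) t.

Let slice_bilin phi :
  bilinear_for *:%R *:%R (fun (u : U) (w : W) => (phi w : k) *: u).
Proof.
split=> [w a u u'|u a w w'] /=; last by rewrite linearP scalerDl scalerA.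
by rewrite scalerDr !scalerA mulrC.
Qed.

Lemma slice_pure phi u w : slice phi (u ⊙ w) = (phi w : k) *: u.
Proof. exact: tlift_pure. Qed.
Lemma slice_linear phi : linear (slice phi).
Proof. exact: tlift_linear. Qed.
HB.instance Definition _ phi :=
  GRing.isLinear.Build k (U ⊗ W) U *:%R (slice phi) (slice_linear phi).

Lemma slice0 phi : slice phi 0 = 0.
Proof. exact: linear0. Qed.
Lemma sliceD phi s t : slice phi (s + t) = slice phi s + slice phi t.
Proof. exact: linearD. Qed.

Lemma eq_slice phi phi' : phi =1 phi' -> slice phi =1 slice phi'.
Proof. by move=> E; apply: eq_tlift => u w; rewrite E. Qed.

(** Every tensor is determined by its slices, and lies in (slices) ⊗ W.  The
    proof keeps a finite-rank idempotent E of W with (id ⊗ E) t = t; to add a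
    term u ⊗ w, E is enlarged by the line through w - E w. *)
Lemma slice_expansion t : exists s : seq ({linear W -> k^o} * W),
  t = \sum_(p <- s) slice p.1 t ⊙ p.2.
Proof.
(* s encodes the operator E s; the sum X s t is (id ⊗ E s) t. *)
pose E (s : seq ({linear W -> k^o} * W)) w := \sum_(p <- s) (p.1 w : k) *: p.2.
pose X (s : seq ({linear W -> k^o} * W)) t := \sum_(p <- s) slice p.1 t ⊙ p.2.
suff [s _ tE] : exists2 s : seq ({linear W -> k^o} * W),
    forall w, E s (E s w) = E s w & t = X s t.
  by exists s.
have E_lin s : linear (E s).
  move=> a w w'; rewrite /E scaler_sumr -big_split /=; apply: eq_bigr => p _.
  by rewrite linearP scalerDl scalerA.
have X_add s t1 t2 : X s (t1 + t2) = X s t1 + X s t2.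
  rewrite /X -big_split /=; apply: eq_bigr => p _.
  by rewrite linearD tpureDl.
have X_pure s u w : X s (u ⊙ w) = u ⊙ E s w.
  rewrite /X /E linear_sumr; apply: eq_bigr => p _.
  by rewrite slice_pure tpureZl linearZr.
elim/tens_ind: t => [|u w t [s EE Xs]].
  by exists [::] => [w|]; rewrite /X /E !big_nil.
have [w0|/eqP w0] := eqVneq (w - E s w) 0.
  exists s => //; rewrite X_add -Xs X_pure; congr (_ ⊙ _ + _).
  by apply/eqP; rewrite -subr_eq0 w0.
pose EL : {linear W -> W} :=
  HB.pack (E s) (GRing.isLinear.Build k W W *:%R (E s) (E_lin s)).
have [phi phiw] : exists phi : {linear W -> k^o}, phi (w - E s w) = 1.
  by apply: functional_ex; apply/eqP.
pose psi w := phi (w - E s w).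
have psi_lin : linear psi.
  by move=> a x y; rewrite /psi E_lin opprD addrACA -scalerBr linearP.
pose psiL : {linear W -> k^o} :=
  HB.pack psi (GRing.isLinear.Build k W k^o *:%R psi psi_lin).
have Ew : E s (w - E s w) = 0.
  by rewrite -[LHS]/(EL _) linearB /= EE subrr.
have psiw : psi (w - E s w) = 1 by rewrite /psi Ew subr0.
have psiE x : psi (E s x) = 0 by rewrite /psi EE subrr linear0.
have EC x : E ((psiL, w - E s w) :: s) x = psi x *: (w - E s w) + E s x.
  by rewrite {1}/E big_cons.
have XC x : X ((psiL, w - E s w) :: s) x = slice psiL x ⊙ (w - E s w) + X s x.
  by rewrite {1}/X big_cons.
exists ((psiL, w - E s w) :: s).
  move=> x; rewrite !EC E_lin Ew scaler0 add0r EE psi_lin psiw psiE addr0.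
  by rewrite -[_ *: 1]/(_ * 1) mulr1.
have psiX x : slice psiL (X s x) = 0.
  elim/tens_ind: x => [|y z x IH].
    by rewrite /X big1 ?linear0 // => p _; rewrite !linear0 linear0l.
  by rewrite X_add linearD /= IH X_pure slice_pure /= psiE scale0r addr0.
rewrite X_add X_pure EC linearDr linearZr /= XC -Xs.
have -> : slice psiL t = 0 by rewrite Xs.
rewrite linear0l add0r; congr (_ + _).
have -> : psi w = 1 by [].
by rewrite scale1r -tpureDr subrK.
Qed.

Lemma slice_eq0 t : (forall phi, slice phi t = 0) -> t = 0.
Proof.
move=> t0; have [s ->] := slice_expansion t.
by rewrite big1 // => p _; rewrite t0 linear0l.
Qed.

(** Flatness in a form suited to kernels: when A is the kernel of f, the
    hypothesis says that (f ⊗ id) t = 0. *)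
Lemma slice_lspan (A : set U) t : (forall phi, A (slice phi t)) ->
  t \in lspan [set v | exists u w, A u /\ v = u ⊙ w].
Proof.
move=> At; have [s ->] := slice_expansion t; apply: rpred_sum => p _.
by apply: mem_lspan; exists (slice p.1 t), p.2.
Qed.
End Slice.

Lemma slice_tmap (k : fieldType) (U W U' W' : lmodType k)
    (f : {linear U -> U'}) (g : {linear W -> W'}) (phi : {linear W' -> k^o}) t :
  slice phi (tmap f g t) = f (slice (phi \o g) t).
Proof.
elim/tens_ind: t => [|u w t IH]; first by rewrite tmap0 !slice0 linear0.
by rewrite tmapD !sliceD linearD /= IH tmap_pure !slice_pure linearZ.
Qed.

Lemma slice_tmap_l (k : fieldType) (U V W : lmodType k) (f : {linear U -> V})
    (phi : {linear W -> k^o}) t :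
  slice phi (tmap f idfun t) = f (slice phi t).
Proof. by rewrite slice_tmap; congr (f _); apply: eq_slice. Qed.

Section TmapInj.
Variables (k : fieldType) (U V W : lmodType k) (f : {linear U -> V}).

Lemma tmap_inj_l : injective f -> injective (tmap f (@idfun W)).
Proof.
move=> f_inj s t /eqP; rewrite -subr_eq0 -linearB /= => /eqP st0.
apply/eqP; rewrite -subr_eq0; apply/eqP/slice_eq0 => phi; apply: f_inj.
by rewrite -slice_tmap_l st0 !linear0.
Qed.

Lemma tmap_lift_l (t : V ⊗ W) :
  (forall phi, exists u, f u = slice phi t) ->
  exists s, tmap f (@idfun W) s = t.
Proof.
move=> ft; have [s ->] := slice_expansion t.
elim: s => [|p s [u IH]]; first by exists 0; rewrite big_nil linear0.
have [v fv] := ft p.1; exists (v ⊙ p.2 + u).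
by rewrite linearD /= IH tmap_pure fv big_cons.
Qed.
End TmapInj.

Section Swap.
Variables (k : fieldType) (U V : lmodType k).

Definition tswap : U ⊗ V -> V ⊗ U := tlift (fun u v => v ⊙ u).

Let swap_bilin : bilinear_for *:%R *:%R (fun (u : U) (v : V) => v ⊙ u).
Proof.
split=> [v a u u'|u a v v'] /=; first by rewrite tpureDr tpureZr.
by rewrite tpureDl tpureZl.
Qed.
Lemma tswap_pure u v : tswap (u ⊙ v) = v ⊙ u.
Proof. exact: tlift_pure. Qed.
Lemma tswap_linear : linear tswap.
Proof. exact: tlift_linear. Qed.
HB.instance Definition _ :=
  GRing.isLinear.Build k (U ⊗ V) (V ⊗ U) *:%R tswap tswap_linear.
Lemma tswap0 : tswap 0 = 0.
Proof. exact: linear0. Qed.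
Lemma tswapD s t : tswap (s + t) = tswap s + tswap t.
Proof. exact: linearD. Qed.
End Swap.

Lemma tmap_inj_r (k : fieldType) (U V W : lmodType k) (f : {linear U -> V}) :
  injective f -> injective (tmap (@idfun W) f).
Proof.
move=> f_inj; have swapK : cancel (@tswap k W U) (@tswap k U W).
  elim/tens_ind=> [|u v t IH]; first by rewrite !tswap0.
  by rewrite !tswapD IH !tswap_pure.
have swapE t : tswap (tmap (@idfun W) f t) = tmap f (@idfun W) (tswap t).
  elim/tens_ind: t => [|u v t IH]; first by rewrite !(tmap0, tswap0).
  by rewrite !(tmapD, tswapD) IH tmap_pure !tswap_pure tmap_pure.
move=> s t /(congr1 (@tswap k W V)); rewrite !swapE => /(tmap_inj_l f_inj).
exact: can_inj.
Qed.

Lemma tmap_comp (k : fieldType) (U V W U' V' W' : lmodType k)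
    (f : {linear U -> V}) (g : {linear V -> W})
    (f' : {linear U' -> V'}) (g' : {linear V' -> W'}) t :
  tmap g g' (tmap f f' t) = tmap (g \o f) (g' \o f') t.
Proof.
elim/tens_ind: t => [|u v t IH]; first by rewrite !tmap0.
by rewrite !tmapD IH !tmap_pure.
Qed.

Lemma eq_tmap (k : fieldType) (U V U' V' : lmodType k)
    (f g : U -> V) (f' g' : U' -> V') :
  f =1 g -> f' =1 g' -> tmap f f' =1 tmap g g'.
Proof. by move=> fg fg'; apply: eq_tlift => u v; rewrite fg fg'. Qed.

Lemma tassoc_tmap (k : fieldType) (U V W U' V' W' : lmodType k)
    (f : {linear U -> U'}) (g : {linear V -> V'}) (h : {linear W -> W'}) t :
  tassoc (tmap (tmap f g) h t) = tmap f (tmap g h) (tassoc t).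
Proof.
elim/tens_ind: t => [|s w t IH]; first by rewrite !(tmap0, tassoc0).
rewrite !(tmapD, tassocD) IH; congr (_ + _); clear t IH.
elim/tens_ind: s => [|u v t IH]; first by rewrite tpure0l !(tmap0, tassoc0).
rewrite tpureDl !(tmapD, tassocD) IH !tmap_pure /= tmap_pure !tassoc_pure.
by rewrite !tmap_pure /= tmap_pure.
Qed.

Lemma slice_tassoc (k : fieldType) (U V W : lmodType k)
    (phi : {linear W -> k^o}) (t : (U ⊗ V) ⊗ W) :
  slice phi t = tmap idfun (slice phi) (tassoc t).
Proof.
elim/tens_ind: t => [|s w t IH]; first by rewrite slice0 tassoc0 tmap0.
rewrite sliceD tassocD tmapD IH slice_pure; congr (_ + _); clear t IH.
elim/tens_ind: s => [|u v t IH].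
  by rewrite tpure0l scaler0 tassoc0 tmap0.
rewrite tpureDl scalerDr tassocD tmapD IH; congr (_ + _).
by rewrite tassoc_pure tmap_pure /= slice_pure tpureZr.
Qed.

Lemma tmap_slice (k : fieldType) (U V W : lmodType k) (v : V)
    (phi : {linear W -> k^o}) (g : {linear W -> V}) (t : U ⊗ W) :
  (forall w, g w = (phi w : k) *: v) -> tmap idfun g t = slice phi t ⊙ v.
Proof.
move=> gE; elim/tens_ind: t => [|u w t IH]; first by rewrite tmap0 slice0 tpure0l.
by rewrite tmapD sliceD IH tmap_pure slice_pure gE tpureDl tpureZl tpureZr.
Qed.

Lemma tpureM (k : fieldType) (A C : algType k) (a a' : A) (c c' : C) :
  (a ⊙ c) * (a' ⊙ c') = (a * a') ⊙ (c * c').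
Proof. exact: tmul_pure. Qed.

Section TmapAlg.
Variables (k : fieldType) (A C A' C' : algType k).
Variables (f : {lrmorphism A -> A'}) (g : {lrmorphism C -> C'}).

Lemma tmap_monoid : monoid_morphism (tmap f g : A ⊗ C -> A' ⊗ C').
Proof.
split; first by rewrite [LHS]tmap_pure !rmorph1.
move=> s t; elim/tens_ind: s => [|a c s IH]; first by rewrite mul0r tmap0 mul0r.
rewrite mulrDl !tmapD IH mulrDl; congr (_ + _); clear s IH.
elim/tens_ind: t => [|a' c' t IH]; first by rewrite mulr0 tmap0 mulr0.
by rewrite mulrDr !tmapD IH mulrDr tpureM !tmap_pure tpureM !rmorphM.
Qed.
HB.instance Definition _ :=
  GRing.isMonoidMorphism.Build (A ⊗ C) (A' ⊗ C') (tmap f g) tmap_monoid.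
End TmapAlg.

Lemma tmap_mull (k : fieldType) (W : lmodType k) (A C : algType k) (c : C)
    (f g : {linear W -> C}) (t : A ⊗ W) :
  (forall w, c * f w = g w) -> (1 ⊙ c) * tmap idfun f t = tmap idfun g t.
Proof.
move=> fg; elim/tens_ind: t => [|a w t IH]; first by rewrite !tmap0 mulr0.
by rewrite !tmapD mulrDr IH !tmap_pure tpureM mul1r fg.
Qed.

Section TassocAlg.
Variables (k : fieldType) (A B C : algType k).

Lemma tassoc_monoid : monoid_morphism (@tassoc k A B C).
Proof.
split; first by rewrite [LHS]tassoc_pure.
move=> s t; elim/tens_ind: s => [|r c s IH].
  by rewrite mul0r tassoc0 mul0r.
rewrite mulrDl !tassocD IH mulrDl; congr (_ + _); clear s IH.
elim/tens_ind: t => [|r' c' t IH]; first by rewrite mulr0 tassoc0 mulr0.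
rewrite mulrDr !tassocD IH mulrDr; congr (_ + _); clear t IH.
rewrite tpureM; elim/tens_ind: r => [|a b r IH].
  by rewrite !(mul0r, tpure0l, tassoc0).
rewrite mulrDl !(tpureDl, tassocD) IH mulrDl; congr (_ + _); clear r IH.
elim/tens_ind: r' => [|a' b' r IH]; first by rewrite !(mulr0, tpure0l, tassoc0).
rewrite mulrDr !(tpureDl, tassocD) IH mulrDr; congr (_ + _); clear r IH.
by rewrite tpureM !tassoc_pure !tpureM.
Qed.
HB.instance Definition _ := GRing.isMonoidMorphism.Build
  ((A ⊗ B) ⊗ C) (A ⊗ (B ⊗ C)) (@tassoc k A B C) tassoc_monoid.
End TassocAlg.

(** * Algebra maps out of a calculus *)

Section CalculusFacts.
Variables (k : fieldType) (A : algType k) (O : calculus A).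
Implicit Types v w : O.

Lemma gpr0M v w : gpr 0 (v * w) = gpr 0 v * gpr 0 w.
Proof.
elim/homog_ind: v => [|m v v' hv IH]; first by rewrite mul0r linear0 mul0r.
rewrite mulrDl !linearD /= IH mulrDl; congr (_ + _); clear v' IH.
elim/homog_ind: w => [|n w w' hw IH]; first by rewrite mulr0 linear0 mulr0.
rewrite mulrDr !linearD /= IH mulrDr; congr (_ + _); clear w' IH.
rewrite (gpr_homog _ (gprM hv hw)) (gpr_homog _ hv) (gpr_homog _ hw).
by case: m {hv} => [|m]; case: n {hw} => [|n]; rewrite ?(mul0r, mulr0).
Qed.

Lemma cpr1 : cpr (1 : O) = 1.
Proof. by rewrite -(rmorph1 (@cin k A O)) cinK. Qed.
Lemma cprM v w : cpr (v * w) = cpr v * cpr w.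
Proof. by apply: (can_inj (@cinK k A O)); rewrite rmorphM /= !cprK gpr0M. Qed.

Lemma cpr_pos n w : homog n w -> (0 < n)%N -> cpr w = 0.
Proof.
move=> hw n0; apply: (can_inj (@cinK k A O)).
by rewrite cprK (gpr_homog _ hw) linear0 ltn_eqF.
Qed.

Lemma cpr_dif w : cpr (dif w) = 0.
Proof.
elim/homog_ind: w => [|n v w hv IH]; first by rewrite !linear0.
by rewrite !linearD /= IH addr0 (cpr_pos (gpr_dif hv)).
Qed.

Lemma calculus_ind (P : O -> Prop) :
  P 0 -> (forall v w, P v -> P w -> P (v + w)) ->
  (forall a w, P w -> P (a *: w)) ->
  (forall a, P (cin a)) ->
  (forall a w, P w -> P (cin a * dif w)) -> forall w, P w.
Proof.
move=> P0 PD PZ Pcin Pd w; elim/homog_ind: w => // n v w hv Pw.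
apply: (PD) => // {w Pw}; elim: n v hv => [|n IH] v hv.
  by rewrite -(cin_cpr hv).
have /lspanP[s sA ->] := density hv.
rewrite big_seq; elim/big_rec: _ => // p w /sA [a [u hu ->]] Pw.
by apply: (PD) => //; apply: (PZ); apply: (Pd); apply: IH.
Qed.

(** By density a calculus is generated by A and d.  The target need not be
    graded: this will be applied to maps into ungraded tensor products, on which
    D is d acting on a single factor. *)
Lemma calculus_hom_uniq (C : algType k) (D : C -> C)
    (f g : {lrmorphism O -> C}) :
  (forall a, f (cin a) = g (cin a)) ->
  (forall w, f (dif w) = D (f w)) -> (forall w, g (dif w) = D (g w)) ->
  f =1 g.
Proof.
move=> fg fd gd; elim/calculus_ind => //.
- by rewrite !linear0.
- by move=> v w IHv IHw; rewrite !linearD /= IHv IHw.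
- by move=> a w IH; rewrite !linearZ /= IH.
- by move=> a w IH; rewrite !rmorphM /= fg fd gd IH.
Qed.
End CalculusFacts.

(** * The coactions of X on forms *)

Lemma gtdif0 (k : fieldType) (D E : dga k) : gtdif (0 : gtens D E) = 0.
Proof. exact: linear0. Qed.
Lemma gtdifD (k : fieldType) (D E : dga k) (s t : gtens D E) :
  gtdif (s + t) = gtdif s + gtdif t.
Proof. exact: linearD. Qed.

Lemma gtpr0 (k : fieldType) (D E : dga k) n : gtpr n (0 : gtens D E) = 0.
Proof. exact: linear0. Qed.
Lemma gtprD (k : fieldType) (D E : dga k) n (s t : gtens D E) :
  gtpr n (s + t) = gtpr n s + gtpr n t.
Proof. exact: linearD. Qed.

Section Coactions.
Variables (k : fieldType) (X : hopf k) (O : bicov X).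

(* The product on the source carries the Koszul sign and that on the target does
   not; the sign is trivial wherever the projection to degree 0 does not vanish. *)
Let cprl_monoid : monoid_morphism (tmap cpr idfun : gtens O O -> X ⊗ O).
Proof.
split; first by rewrite [LHS]tmap_pure /= cpr1.
move=> s t; elim/gtens_ind: s => [|p q a b s ha hb IH].
  by rewrite mul0r tmap0 mul0r.
rewrite mulrDl !tmapD IH mulrDl; congr (_ + _); clear s IH.
elim/gtens_ind: t => [|p' q' a' b' t ha' hb' IH].
  by rewrite mulr0 tmap0 mulr0.
rewrite mulrDr !tmapD IH mulrDr; congr (_ + _); clear t IH.
rewrite -[_ * _]/(gtmul _ _) (gtmul_pure _ _ hb ha') linearZ /= !tmap_pure.
rewrite tpureM /= cprM.
case: p' ha' => [|p'] ha'; first by rewrite muln0 scale1r.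
by rewrite (cpr_pos ha') // mulr0 tpure0l scaler0.
Qed.

Let cprr_monoid : monoid_morphism (tmap idfun cpr : gtens O O -> O ⊗ X).
Proof.
split; first by rewrite [LHS]tmap_pure /= cpr1.
move=> s t; elim/gtens_ind: s => [|p q a b s ha hb IH].
  by rewrite mul0r tmap0 mul0r.
rewrite mulrDl !tmapD IH mulrDl; congr (_ + _); clear s IH.
elim/gtens_ind: t => [|p' q' a' b' t ha' hb' IH].
  by rewrite mulr0 tmap0 mulr0.
rewrite mulrDr !tmapD IH mulrDr; congr (_ + _); clear t IH.
rewrite -[_ * _]/(gtmul _ _) (gtmul_pure _ _ hb ha') linearZ /= !tmap_pure.
rewrite tpureM /= cprM.
case: q hb => [|q] hb; first by rewrite mul0n scale1r.
by rewrite (cpr_pos hb) // mul0r tpure0r scaler0.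
Qed.

HB.instance Definition _ :=
  GRing.isLinear.Build k O (X ⊗ O) *:%R (@lcoact k X O) (@lcoact_linear k X O).

Lemma lcoact_monoid : monoid_morphism (@lcoact k X O).
Proof.
split=> [|v w]; first by rewrite /lcoact rmorph1; exact: cprl_monoid.1.
by rewrite /lcoact rmorphM; exact: cprl_monoid.2.
Qed.
HB.instance Definition _ :=
  GRing.isMonoidMorphism.Build O (X ⊗ O) (@lcoact k X O) lcoact_monoid.

Lemma rcoact_linear : linear (@rcoact k X O).
Proof. by move=> a u v; rewrite /rcoact linearP; exact: tmap_linear. Qed.
HB.instance Definition _ :=
  GRing.isLinear.Build k O (O ⊗ X) *:%R (@rcoact k X O) rcoact_linear.

Lemma rcoact_monoid : monoid_morphism (@rcoact k X O).
Proof.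
split=> [|v w]; first by rewrite /rcoact rmorph1; exact: cprr_monoid.1.
by rewrite /rcoact rmorphM; exact: cprr_monoid.2.
Qed.
HB.instance Definition _ :=
  GRing.isMonoidMorphism.Build O (O ⊗ X) (@rcoact k X O) rcoact_monoid.

Lemma lcoact_cin (x : X) : lcoact (cin x : O) = tmap idfun cin (Delta x).
Proof.
rewrite /lcoact (Delta_sE O) [LHS]tmap_comp.
by apply: eq_tmap => // y; rewrite /= cinK.
Qed.

Lemma rcoact_cin (x : X) : rcoact (cin x : O) = tmap cin idfun (Delta x).
Proof.
rewrite /rcoact (Delta_sE O) [LHS]tmap_comp.
by apply: eq_tmap => // y; rewrite /= cinK.
Qed.

Lemma lcoact_dif (w : O) : lcoact (dif w) = tmap idfun dif (lcoact w).
Proof.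
rewrite /lcoact dgmap_dif -[dif _]/(gtdif _).
elim/gtens_ind: (Delta_s w) => [|p q a b t ha hb IH].
  by rewrite gtdif0 !tmap0.
rewrite gtdifD !tmapD IH (gtdif_pure _ ha) tmapD; congr (_ + _).
rewrite linearZ /= !tmap_pure /= cpr_dif tpure0l add0r.
case: p ha => [|p] ha; first by rewrite scale1r.
by rewrite (cpr_pos ha) // !tpure0l scaler0.
Qed.

Lemma rcoact_dif (w : O) : rcoact (dif w) = tmap dif idfun (rcoact w).
Proof.
rewrite /rcoact dgmap_dif -[dif _]/(gtdif _).
elim/gtens_ind: (Delta_s w) => [|p q a b t ha hb IH].
  by rewrite gtdif0 !tmap0.
rewrite gtdifD !tmapD IH (gtdif_pure _ ha) tmapD linearZ /= !tmap_pure /=.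
by rewrite cpr_dif tpure0r scaler0 addr0.
Qed.
End Coactions.

(** * The coaction of H on forms *)

Section Base.
Variables (k : fieldType) (X H : hopf k) (pi : {lrmorphism X -> H}).

Lemma rho_linear : linear (@rho k X H pi).
Proof. exact: (linearP (tmap idfun pi \o @Delta k X)). Qed.
HB.instance Definition _ :=
  GRing.isLinear.Build k X (X ⊗ H) *:%R (@rho k X H pi) rho_linear.

Lemma rho_monoid : monoid_morphism (@rho k X H pi).
Proof. by split=> [|x y]; rewrite /rho ?rmorph1 ?rmorphM. Qed.

Lemma base1 : base pi 1.
Proof. exact: rho_monoid.1. Qed.

Lemma baseM x y : base pi x -> base pi y -> base pi (x * y).
Proof.
move=> bx bY; rewrite /base /coinv /= rho_monoid.2 [rho pi x]bx [rho pi y]bY.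
by rewrite tpureM mulr1.
Qed.
End Base.

Section RightCoaction.
Variables (k : fieldType) (X H : hopf k) (OX : bicov X).
Variable pi : {lrmorphism X -> H}.

Definition hcoact (w : OX) : OX ⊗ H := tmap idfun pi (rcoact w).

Lemma hcoact_linear : linear hcoact.
Proof. exact: (linearP (tmap idfun pi \o @rcoact k X OX)). Qed.
HB.instance Definition _ :=
  GRing.isLinear.Build k OX (OX ⊗ H) *:%R hcoact hcoact_linear.
Lemma hcoact_monoid : monoid_morphism hcoact.
Proof. by split=> [|v w]; rewrite /hcoact ?rmorph1 ?rmorphM. Qed.
HB.instance Definition _ :=
  GRing.isMonoidMorphism.Build OX (OX ⊗ H) hcoact hcoact_monoid.

Lemma hcoact_cin x : hcoact (cin x) = tmap cin pi (Delta x).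
Proof. by rewrite /hcoact rcoact_cin tmap_comp; apply: eq_tmap. Qed.

Lemma hcoact_rho x : hcoact (cin x) = tmap cin idfun (rho pi x).
Proof. by rewrite hcoact_cin /rho tmap_comp; apply: eq_tmap. Qed.

Lemma hcoact_dif w : hcoact (dif w) = tmap dif idfun (hcoact w).
Proof. by rewrite /hcoact rcoact_dif !tmap_comp. Qed.

Lemma hcoact_gpr n w : hcoact (gpr n w) = tmap (gpr n) idfun (hcoact w).
Proof.
rewrite /hcoact /rcoact dgmap_gpr tmap_comp -[gpr n _]/(gtpr n _) tmap_comp.
rewrite tmap_comp.
elim/gtens_ind: (Delta_s w) => [|p q a b t ha hb IH].
  by rewrite !tmap0 gtpr0 tmap0.
rewrite gtprD !tmapD {}IH (gtpr_pure _ ha hb) !tmap_pure /=.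
congr (_ + _); rewrite (gpr_homog _ ha).
case: q hb => [|q] hb.
  by rewrite addn0; case: eqP => _; rewrite ?tmap_pure // tmap0 tpure0l.
rewrite (cpr_pos hb) // linear0 tpure0r; case: eqP => _; last exact: tmap0.
by rewrite tmap_pure /= (cpr_pos hb) // linear0 tpure0r.
Qed.

(** The left X-coaction and the right H-coaction commute.  Both sides are algebra
    maps in w that intertwine d with id ⊗ d ⊗ id, so that only functions remain,
    and there it is coassociativity. *)
Lemma hcoact_lcoact w :
  tassoc (tmap (@lcoact k X OX) idfun (hcoact w)) = tmap idfun hcoact (lcoact w).
Proof.
pose F : {lrmorphism OX -> X ⊗ (OX ⊗ H)} :=
  @tassoc k X OX H \o tmap (@lcoact k X OX) idfun \o hcoact.
pose G : {lrmorphism OX -> X ⊗ (OX ⊗ H)} := tmap idfun hcoact \o @lcoact k X OX.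
apply: (@calculus_hom_uniq k X OX _ (tmap idfun (tmap dif idfun)) F G).
- move=> x; rewrite /F /G /= hcoact_cin lcoact_cin !tmap_comp.
  rewrite [X in tassoc X](_ : _ =
      tmap (tmap idfun cin) pi (tmap Delta idfun (Delta x))); last first.
    by rewrite tmap_comp; apply: eq_tmap => y; [exact: lcoact_cin|].
  rewrite tassoc_tmap coassoc tmap_comp; apply: eq_tmap => y; first by [].
  by rewrite /= hcoact_cin.
- move=> v; rewrite /F /= hcoact_dif -tassoc_tmap !tmap_comp; congr tassoc.
  by apply: eq_tmap => u; first exact: lcoact_dif.
- move=> v; rewrite /G /= lcoact_dif !tmap_comp.
  by apply: eq_tmap => u; last exact: hcoact_dif.
Qed.

(** As the left X-coaction and the right H-coaction commute, all slices of
    hcoact ξ are left-invariant, so that hcoact ξ does lie in L^1 ⊗ H. *)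
Lemma coactL_spec (xi : L1 OX) :
  tmap val idfun (coactL pi xi) = hcoact (val xi).
Proof.
have [s sE] : exists s : L1 OX ⊗ H,
    tmap (val : L1 OX -> OX) idfun s = hcoact (val xi).
  pose f : {linear L1 OX -> OX} := val.
  apply: (tmap_lift_l (f := f)) => phi; have /asboolP[hxi lxi] := L1valP xi.
  have linv_s : slice phi (hcoact (val xi)) \in @linv k X OX.
    apply/asboolP; split.
      rewrite /homog /= -[RHS](_ : slice phi (hcoact (gpr 1 (val xi))) = _).
        by rewrite hcoact_gpr slice_tmap_l.
      by rewrite [gpr 1 _]hxi.
    rewrite -slice_tmap_l slice_tassoc hcoact_lcoact [lcoact _]lxi.
    by rewrite tmap_pure /= tmap_pure.
  by exists (MkL1 linv_s).
exact: (@xgetI _ 0 [set t | tmap val idfun t = hcoact (val xi)] s).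
Qed.

Lemma coactL_linear : linear (coactL pi : L1 OX -> L1 OX ⊗ H).
Proof.
move=> a u v; apply: (@tmap_inj_l _ _ _ _ (val : L1 OX -> OX)) => //.
  exact: val_inj.
by rewrite linearP /= !coactL_spec !linearP.
Qed.
HB.instance Definition _ :=
  GRing.isLinear.Build k (L1 OX) (L1 OX ⊗ H) *:%R (coactL pi) coactL_linear.
End RightCoaction.

(** * Products of forms and tensor product coactions *)

Section Combine.
Variables (k : fieldType) (H : hopf k) (U V : lmodType k).

Definition tcombine (s : U ⊗ H) (t : V ⊗ H) : (U ⊗ V) ⊗ H :=
  tlift (fun u0 u1 => tlift (fun v0 v1 => (u0 ⊙ v0) ⊙ (u1 * v1)) t) s.

Let bilin1 u0 u1 : bilinear_for *:%R *:%R
  (fun (v0 : V) (v1 : H) => ((u0 : U) ⊙ v0) ⊙ (u1 * v1)).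
Proof.
split=> [v1 a v v'|v0 a v v'] /=; first by rewrite !(tpureDr, tpureDl) tpureZr tpureZl.
by rewrite mulrDr tpureDr -scalerAr tpureZr.
Qed.

Let bilin2 t : bilinear_for *:%R *:%R (fun (u0 : U) (u1 : H) =>
   tlift (fun (v0 : V) v1 => (u0 ⊙ v0) ⊙ (u1 * v1)) t).
Proof.
split=> [y b x x'|x b y y'] /=; rewrite -tlift_funP; apply: eq_tlift => u v /=.
  by rewrite !(tpureDr, tpureDl) !tpureZl.
by rewrite mulrDl tpureDr -scalerAl tpureZr.
Qed.

Lemma tcombine_pure u0 u1 v0 v1 :
  tcombine (u0 ⊙ u1) (v0 ⊙ v1) = (u0 ⊙ v0) ⊙ (u1 * v1).
Proof. by rewrite /tcombine !tlift_pure. Qed.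
Lemma tcombine_bilinear : bilinear_for *:%R *:%R tcombine.
Proof.
split=> [t|s] a x y /=; first exact: tlift_linear.
rewrite /tcombine -tlift_funP; apply: eq_tlift => u v; exact: tlift_linear.
Qed.
HB.instance Definition _ := bilinear_isBilinear.Build k (U ⊗ H) (V ⊗ H)
  ((U ⊗ V) ⊗ H) *:%R *:%R tcombine tcombine_bilinear.

Section Tcoact.
Variables (a : {linear U -> U ⊗ H}) (b : {linear V -> V ⊗ H}).

Let bilin3 : bilinear_for *:%R *:%R (fun (u : U) (v : V) => tcombine (a u) (b v)).
Proof. by split=> [v|u] c x y /=; rewrite linearP ?linearPl ?linearPr. Qed.

Lemma tcoact_pure u v : tcoact a b (u ⊙ v) = tcombine (a u) (b v).
Proof. exact: (tlift_pure bilin3). Qed.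
Lemma tcoact_linear : linear (tcoact a b).
Proof. exact: (tlift_linear bilin3). Qed.
HB.instance Definition _ := GRing.isLinear.Build k (U ⊗ V) ((U ⊗ V) ⊗ H) *:%R
  (tcoact a b) tcoact_linear.
End Tcoact.

(** When m multiplies the images of U and V in an algebra C, m ⊗ id turns the
    tensor product of coactions into the product of C ⊗ H. *)
Lemma tmap_tcombine (C : algType k) (m : {linear U ⊗ V -> C})
    (f : {linear U -> C}) (g : {linear V -> C}) s t :
  (forall u v, m (u ⊙ v) = f u * g v) ->
  tmap m idfun (tcombine s t) = tmap f idfun s * tmap g idfun t.
Proof.
move=> mE; elim/tens_ind: s => [|u h s IH].
  by rewrite linear0l !tmap0 mul0r.
rewrite linearDl !tmapD IH mulrDl; congr (_ + _); clear s IH.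
elim/tens_ind: t => [|v h' t IH]; first by rewrite linear0r !tmap0 mulr0.
rewrite linearDr !tmapD IH mulrDr; congr (_ + _); clear t IH.
by rewrite /= tcombine_pure !tmap_pure /= mE tpureM.
Qed.
End Combine.

Section MulPow.
Variables (k : fieldType) (X : hopf k) (O : bicov X).

Let mulpow_bilin n : linear (@mulpow k X O n) -> bilinear_for *:%R *:%R
  (fun (xi : L1 O) (t : tpow (L1 O) n) => val xi * mulpow t).
Proof.
move=> IH; split=> [t a x y|xi a s t] /=; first by rewrite mulrDl -scalerAl.
by rewrite (IH a s t) mulrDr -scalerAr.
Qed.

Lemma mulpow_linear n : linear (@mulpow k X O n).
Proof.
elim: n => [|n IH]; last exact: (tlift_linear (mulpow_bilin IH)).
by move=> a x y; rewrite /= scalerDl scalerA.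
Qed.
HB.instance Definition _ n := GRing.isLinear.Build k (tpow (L1 O) n) O *:%R
  (@mulpow k X O n) (@mulpow_linear n).

Lemma mulpow_pure n (xi : L1 O) (t : tpow (L1 O) n) :
  mulpow (xi ⊙ t : tpow (L1 O) n.+1) = val xi * mulpow t.
Proof. exact: (tlift_pure (mulpow_bilin (@mulpow_linear n))). Qed.

Lemma mulpow_tpows n (v : 'I_n -> L1 O) :
  mulpow (tpows v) = \prod_(i < n) val (v i).
Proof.
elim: n v => [|n IH] v; first by rewrite big_ord0 /= scale1r.
by rewrite [LHS]mulpow_pure IH big_ord_recl.
Qed.

Hypothesis OW : woronowicz O.

Let mulpow_rel n t : @braid_rel k X O n t -> mulpow t = 0.
Proof. exact: OW.1. Qed.

Definition mulext n : {linear extpow O n -> O} :=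
  HB.pack (qlift (@mulpow k X O n))
    (GRing.isLinear.Build k (extpow O n) O *:%R (qlift (@mulpow k X O n))
      (qlift_linear (f := @mulpow k X O n) (@mulpow_rel n))).

Lemma mulext_proj n t : mulext n (qproj _ t) = mulpow t.
Proof. exact: (qlift_qproj (f := @mulpow k X O n) (@mulpow_rel n)). Qed.

Let formmul_bilin n : bilinear_for *:%R *:%R
  (fun (xi : extpow O n) (x : X) => mulext n xi * cin x).
Proof.
split=> [x a u v|u a x y] /=; last by rewrite linearP mulrDr -scalerAr.
by have /= -> := linearP (mulext n) a u v; rewrite mulrDl -scalerAl.
Qed.

Lemma formmul_linear n : linear (formmul O n).
Proof. exact: (tlift_linear (@formmul_bilin n)). Qed.
Definition formmulL n : {linear extpow O n ⊗ X -> O} :=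
  HB.pack (formmul O n) (GRing.isLinear.Build k (extpow O n ⊗ X) O *:%R
    (formmul O n) (@formmul_linear n)).

Lemma formmul_pure n q x : formmul O n (q ⊙ x) = mulext n q * cin x.
Proof. exact: (tlift_pure (@formmul_bilin n)). Qed.

Lemma formmul_inj n : injective (formmul O n).
Proof. exact: (OW.2 n).1. Qed.

(** The case x = 1 of the injectivity of ξ ⊗ x |-> ξ x. *)
Lemma mulext_inj n : injective (mulext n).
Proof.
move=> p q pq; have : formmul O n (p ⊙ 1) = formmul O n (q ⊙ 1).
  by rewrite !formmul_pure pq.
move=> /formmul_inj /(congr1 (slice counit)).
by rewrite !slice_pure rmorph1 !scale1r.
Qed.
End MulPow.

Section Colinear.
Variables (k : fieldType) (X H : hopf k) (OX : bicov X).
Variable pi : {lrmorphism X -> H}.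

Lemma coactpow_linear n : linear (@coactpow k X H OX pi n).
Proof.
elim: n => [|n IH]; first by move=> a x y; rewrite /= tpureDl tpureZl.
pose c : {linear tpow (L1 OX) n -> tpow (L1 OX) n ⊗ H} :=
  HB.pack (@coactpow k X H OX pi n) (GRing.isLinear.Build k _ _ *:%R _ IH).
exact: (tcoact_linear (coactL pi) c).
Qed.
HB.instance Definition _ n := GRing.isLinear.Build k (tpow (L1 OX) n)
  (tpow (L1 OX) n ⊗ H) *:%R (@coactpow k X H OX pi n) (@coactpow_linear n).

Lemma coactpow_pure n (xi : L1 OX) (t : tpow (L1 OX) n) :
  coactpow pi (xi ⊙ t : tpow (L1 OX) n.+1) =
  tcombine (coactL pi xi) (coactpow pi t).
Proof. exact: (tcoact_pure (coactL pi) (@coactpow k X H OX pi n)). Qed.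

Lemma hcoact_mulpow n (t : tpow (L1 OX) n) :
  hcoact pi (mulpow t) = tmap (@mulpow k X OX n) idfun (coactpow pi t).
Proof.
elim: n t => [|n IH] t.
  rewrite [coactpow pi t]/= tmap_pure.
  by rewrite /= linearZ /= rmorph1 tpureZl.
pose f : {linear tpow (L1 OX) n.+1 -> OX ⊗ H} := hcoact pi \o @mulpow k X OX n.+1.
pose g : {linear tpow (L1 OX) n.+1 -> OX ⊗ H} :=
  tmap (@mulpow k X OX n.+1) idfun \o @coactpow k X H OX pi n.+1.
suff fg xi (s : tpow (L1 OX) n) : f (xi ⊙ s) = g (xi ⊙ s).
  exact: (@tens_ext _ _ _ _ f g fg).
rewrite -[LHS]/(hcoact pi (mulpow (xi ⊙ s : tpow _ n.+1))).
rewrite -[RHS]/(tmap _ _ (coactpow pi (xi ⊙ s : tpow _ n.+1))).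
rewrite mulpow_pure coactpow_pure rmorphM /= IH -coactL_spec.
pose m : {linear L1 OX ⊗ tpow (L1 OX) n -> OX} :=
  HB.pack (@mulpow k X OX n.+1) (GRing.isLinear.Build k
    (L1 OX ⊗ tpow (L1 OX) n) OX *:%R _ (@mulpow_linear k X OX n.+1)).
apply: esym; apply: (@tmap_tcombine k H _ _ _ m val (@mulpow k X OX n)).
exact: mulpow_pure.
Qed.

Hypothesis OW : woronowicz OX.

(* The coaction is compatible with the relations of (L^1)^{∧n}.  Instead of
   checking that the braiding is colinear, the relation is pushed into Ω, where
   (L^1)^{∧n} ⊗ H embeds and the coaction has become [hcoact]. *)
Let coactpow_rel n t : @braid_rel k X OX n t ->
  tmap (qproj (@braid_rel k X OX n)) idfun (coactpow pi t) = 0.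
Proof.
move=> rt; apply: (tmap_inj_l (@mulext_inj _ _ _ OW n)).
rewrite linear0 tmap_comp.
transitivity (tmap (@mulpow k X OX n) idfun (coactpow pi t)).
  by apply: eq_tmap => // s; exact: mulext_proj.
by rewrite -hcoact_mulpow OW.1 // linear0.
Qed.

Let coactextL n : {linear tpow (L1 OX) n -> extpow OX n ⊗ H} :=
  tmap (qproj (@braid_rel k X OX n)) idfun \o @coactpow k X H OX pi n.

Lemma coactext_linear n : linear (@coactext k X H OX pi n).
Proof. exact: (qlift_linear (f := coactextL n) (@coactpow_rel n)). Qed.

Lemma coactext_proj n t : coactext pi (qproj (@braid_rel k X OX n) t) =
  tmap (qproj _) idfun (coactpow pi t).
Proof. exact: (qlift_qproj (f := coactextL n) (@coactpow_rel n)). Qed.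

Lemma hcoact_mulext n q :
  hcoact pi (mulext OW n q) = tmap (mulext OW n) idfun (coactext pi q).
Proof.
rewrite -[q]qproj_repr mulext_proj coactext_proj hcoact_mulpow tmap_comp.
by apply: eq_tmap => // s; apply: esym; exact: mulext_proj.
Qed.

Lemma hcoact_formmul n t : hcoact pi (formmul OX n t) =
  tmap (formmulL OW n) idfun (coactextX OX pi n t).
Proof.
pose c : {linear extpow OX n -> extpow OX n ⊗ H} :=
  HB.pack (@coactext k X H OX pi n)
    (GRing.isLinear.Build k _ _ *:%R _ (@coactext_linear n)).
pose f : {linear extpow OX n ⊗ X -> OX ⊗ H} := hcoact pi \o formmulL OW n.
pose g : {linear extpow OX n ⊗ X -> OX ⊗ H} :=
  tmap (formmulL OW n) idfun \o tcoact c (rho pi).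
apply: (@tens_ext _ _ _ _ f g) => q x.
rewrite -[LHS]/(hcoact pi (formmul OX n (q ⊙ x))).
rewrite -[RHS]/(tmap (formmulL OW n) idfun (tcoact c (rho pi) (q ⊙ x))).
rewrite tcoact_pure (tmap_tcombine (f := mulext OW n) (g := cin)); last first.
  exact: formmul_pure.
by rewrite formmul_pure rmorphM; congr (_ * _);
  [exact: hcoact_mulext|exact: hcoact_rho].
Qed.

Lemma coinv_formmul n t : coinv (coactextX OX pi n) t <->
  hcoact pi (formmul OX n t) = formmul OX n t ⊙ 1.
Proof.
have tE : tmap (formmulL OW n) idfun (t ⊙ (1 : H)) = formmul OX n t ⊙ 1.
  exact: tmap_pure.
rewrite hcoact_formmul -tE; split=> [-> //|].
exact: (tmap_inj_l (f := formmulL OW n) (@formmul_inj _ _ _ OW n)).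
Qed.
End Colinear.

(** * 1-forms with vanishing vertical part *)

Section OneForms.
Variables (k : fieldType) (X : hopf k) (O : bicov X).
Hypothesis OW : woronowicz O.

(* L^1 as (L^1)^{∧1}; the power L^1 ⊗ k carries a spurious factor k. *)
Let ext1 (xi : L1 O) : extpow O 1 :=
  qproj (@braid_rel k X O 1) (xi ⊙ (1 : k^o) : tpow (L1 O) 1).

Let ext1_linear : linear ext1.
Proof. by move=> a u v; rewrite /ext1 tpureDl tpureZl; exact: linearP. Qed.

Let ext1L : {linear L1 O -> extpow O 1} :=
  HB.pack ext1 (GRing.isLinear.Build k (L1 O) (extpow O 1) *:%R ext1 ext1_linear).

Let mulext_ext1 xi : mulext OW 1 (ext1 xi) = val xi.
Proof.
rewrite mulext_proj mulpow_pure -[mulpow _]/(1 *: 1) scale1r.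
exact: mulr1.
Qed.

Let ext1_inj : injective ext1.
Proof. by move=> u v uv; apply: val_inj; rewrite -!mulext_ext1 uv. Qed.

Definition oneform : {linear L1 O ⊗ X -> O} := formmulL OW 1 \o tmap ext1L idfun.

Lemma oneform_pure xi x : oneform (xi ⊙ x) = val xi * cin x.
Proof.
rewrite -[LHS]/(formmul O 1 (tmap ext1L idfun (xi ⊙ x))) tmap_pure.
by rewrite (formmul_pure OW) -[ext1L xi]/(ext1 xi) mulext_ext1.
Qed.

Lemma oneform_inj : injective oneform.
Proof.
move=> s t /(@formmul_inj k X O OW 1).
exact: (tmap_inj_l (f := ext1L) ext1_inj).
Qed.

Lemma oneform_surj w : homog 1 w -> exists t, oneform t = w.
Proof.
move=> hw; have : range (formmul O 1) w by rewrite (OW.2 1%N).2.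
case=> s _ <-; suff [t <-] : exists t, tmap ext1L idfun t = s by exists t.
elim/tens_ind: s => [|q x s [t tE]]; first by exists 0; rewrite linear0.
have [xi qE] : exists xi, ext1 xi = q.
  rewrite -[q]qproj_repr; move: (repr q) => r.
  elim/tens_ind: r => [|xi a r [eta IH]].
    by exists 0; rewrite -[ext1 0]/(ext1L 0) !linear0.
  exists ((a : k) *: xi + eta); rewrite ext1_linear IH linearD /ext1; congr (_ + _).
  by rewrite -linearZ /= -tpureZr -[a *: 1]/(a * 1) mulr1.
exists (xi ⊙ x + t); rewrite linearD /= tE; congr (_ + _).
by rewrite -qE; exact: (tmap_pure ext1L idfun).
Qed.
End OneForms.

Section Vertical.
Variables (k : fieldType) (X H : hopf k) (OX : bicov X) (OH : bicov H).
Variables (pi : {lrmorphism X -> H}) (pis : dgmap OX OH).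
Hypothesis pi_hopf : hopf_map pi.
Hypothesis pis_extends : extends pi pis.

Lemma lcoact_pis w : lcoact (pis w) = tmap pi pis (lcoact w).
Proof.
pose F : {lrmorphism OX -> H ⊗ OH} := @lcoact k H OH \o pis.
pose G : {lrmorphism OX -> H ⊗ OH} := tmap pi pis \o @lcoact k X OX.
apply: (@calculus_hom_uniq k X OX _ (tmap idfun dif) F G).
- move=> x; rewrite /F /G /= pis_extends !lcoact_cin pi_hopf.1 !tmap_comp.
  by apply: eq_tmap => // y; apply: esym; exact: pis_extends.
- by move=> v; rewrite /F /= dgmap_dif lcoact_dif.
- move=> v; rewrite /G /= lcoact_dif !tmap_comp.
  by apply: eq_tmap => // y; exact: dgmap_dif.
Qed.

Lemma pis_linv (xi : L1 OX) : pis (val xi) \in @linv k H OH.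
Proof.
have /asboolP[hxi lxi] := L1valP xi; apply/asboolP; split.
  by rewrite /homog /= -dgmap_gpr [gpr 1 _]hxi.
by rewrite lcoact_pis [lcoact _]lxi tmap_pure rmorph1.
Qed.

Let piL (xi : L1 OX) : L1 OH := MkL1 (pis_linv xi).
Let piL_linear : linear piL.
Proof. by move=> a u v; apply: val_inj; exact: (linearP pis). Qed.
Let piLL : {linear L1 OX -> L1 OH} :=
  HB.pack piL (GRing.isLinear.Build k (L1 OX) (L1 OH) *:%R piL piL_linear).

(** The map w |-> w_[-1] ⊗ π_*(w_[0]), which measures how far a form is from
    being horizontal. *)
Definition vertical (w : OX) : X ⊗ OH := tmap idfun pis (lcoact w).

Lemma vertical_linear : linear vertical.
Proof. exact: (linearP (tmap idfun pis \o @lcoact k X OX)). Qed.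
HB.instance Definition _ :=
  GRing.isLinear.Build k OX (X ⊗ OH) *:%R vertical vertical_linear.
Lemma vertical_monoid : monoid_morphism vertical.
Proof. by split=> [|v w]; rewrite /vertical ?rmorph1 ?rmorphM. Qed.
HB.instance Definition _ :=
  GRing.isMonoidMorphism.Build OX (X ⊗ OH) vertical vertical_monoid.

Lemma vertical_cin x : vertical (cin x) = tmap idfun cin (rho pi x).
Proof.
rewrite /vertical lcoact_cin /rho !tmap_comp.
by apply: eq_tmap => // y; exact: pis_extends.
Qed.

Lemma vertical_L1 (xi : L1 OX) : vertical (val xi) = 1 ⊙ pis (val xi).
Proof.
have /asboolP[_ lxi] := L1valP xi.
by rewrite /vertical [lcoact _]lxi tmap_pure.
Qed.

Lemma vertical_dif w : vertical (dif w) = tmap idfun dif (vertical w).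
Proof.
rewrite /vertical lcoact_dif !tmap_comp.
by apply: eq_tmap => // y; exact: dgmap_dif.
Qed.

Lemma vertical_dbase b : base pi b -> vertical (dif (cin b)) = 0.
Proof.
move=> bb; rewrite vertical_dif vertical_cin [rho pi b]bb !tmap_pure /=.
by rewrite rmorph1 dif1 linear0r.
Qed.

Section Theta.
Let tpure_linear xi : linear (tpure (piL xi) : H -> L1 OH ⊗ H).
Proof. by move=> a h h'; rewrite tpureDr tpureZr. Qed.
Let tpi xi : {linear H -> L1 OH ⊗ H} :=
  HB.pack (tpure (piL xi)) (GRing.isLinear.Build k H (L1 OH ⊗ H) *:%R
    (tpure (piL xi)) (tpure_linear xi)).

(* [vertical] expressed through the isomorphisms Ω^1 ≅ L^1 ⊗ X and Ω^1 H ≅ L^1 H ⊗ H: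
   ξ ⊗ x |-> x_(1) ⊗ π_*(ξ) ⊗ π(x_(2)). *)
Let theta (t : L1 OX ⊗ X) : X ⊗ (L1 OH ⊗ H) :=
  tlift (fun xi x => tmap idfun (tpi xi) (rho pi x)) t.

Let theta_bilin : bilinear_for *:%R *:%R
  (fun xi x => tmap idfun (tpi xi) (rho pi x) : X ⊗ (L1 OH ⊗ H)).
Proof.
split=> [x a u v|u a x y] /=; last first.
  by rewrite rho_linear; exact: (linearP (tmap idfun (tpi u))).
rewrite /tmap -tlift_funP; apply: eq_tlift => z h /=.
by rewrite -tpureZr -tpureDr -tpureZl -tpureDl -piL_linear.
Qed.
Let thetaL : {linear L1 OX ⊗ X -> X ⊗ (L1 OH ⊗ H)} :=
  HB.pack theta (GRing.isLinear.Build k _ _ *:%R theta (tlift_linear theta_bilin)).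
Let theta_pure xi x :
  thetaL (xi ⊙ x) = tmap idfun (tpi xi) (rho pi x).
Proof. exact: (tlift_pure theta_bilin). Qed.

Hypothesis OXW : woronowicz OX.
Hypothesis OHW : woronowicz OH.

Let vertical_theta t : vertical (oneform OXW t) = tmap idfun (oneform OHW) (thetaL t).
Proof.
pose f : {linear L1 OX ⊗ X -> X ⊗ OH} := vertical \o oneform OXW.
pose g : {linear L1 OX ⊗ X -> X ⊗ OH} := tmap idfun (oneform OHW) \o thetaL.
apply: (@tens_ext _ _ _ _ f g) => xi x.
rewrite -[LHS]/(vertical (oneform OXW (xi ⊙ x))).
rewrite -[RHS]/(tmap idfun (oneform OHW) (thetaL (xi ⊙ x))).
rewrite theta_pure tmap_comp oneform_pure.
transitivity (vertical (val xi) * vertical (cin x)); first exact: rmorphM.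
rewrite vertical_L1 vertical_cin.
by apply: tmap_mull => h; apply: esym; exact: oneform_pure.
Qed.

(* Applying the counit of H recovers π_*(ξ) ⊗ x. *)
Let counit_theta t :
  tswap (tmap idfun (slice counit) (thetaL t)) = tmap piLL idfun t.
Proof.
pose f : {linear L1 OX ⊗ X -> L1 OH ⊗ X} :=
  @tswap k _ _ \o tmap idfun (slice counit) \o thetaL.
pose g : {linear L1 OX ⊗ X -> L1 OH ⊗ X} := tmap piLL idfun.
apply: (@tens_ext _ _ _ _ f g) => xi x.
rewrite -[LHS]/(tswap (tmap idfun (slice counit) (thetaL (xi ⊙ x)))).
rewrite -[RHS]/(tmap piLL idfun (xi ⊙ x)) tmap_pure theta_pure tmap_comp.
rewrite (@tmap_slice _ _ _ _ (piL xi) counit); last by move=> h; exact: slice_pure.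
rewrite tswap_pure; congr (_ ⊙ _); rewrite /rho slice_tmap /= -[RHS]counitr.
by apply: eq_slice => y; exact: pi_hopf.2.
Qed.

(** If [vertical] kills Σ ξ_i x_i, then Σ π_*(ξ_i) ⊗ x_i = 0 by the injectivity of
    L^1 H ⊗ H -> Ω^1 H, that is, Σ ξ_i ⊗ x_i lies in K ⊗ X. *)
Lemma kernel_vertical w : homog 1 w -> vertical w = 0 ->
  w \in lspan [set w | exists xi x, Kforms pis xi /\ w = val xi * cin x].
Proof.
move=> /(oneform_surj OXW) [t <-]; rewrite vertical_theta => t0.
have {}t0 : thetaL t = 0.
  by apply: (tmap_inj_r (@oneform_inj _ _ _ OHW)); rewrite t0 tmap0.
have {}t0 : tmap piLL idfun t = 0 by rewrite -counit_theta t0 tmap0 tswap0.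
have Kt phi : Kforms pis (slice phi t).
  have := congr1 (slice phi) t0; rewrite slice_tmap_l linear0.
  by move/(congr1 (val : L1 OH -> OH)).
apply: lspan_map (slice_lspan Kt) => _ [xi [x [Kxi ->]]].
by apply: mem_lspan; exists xi, x; rewrite oneform_pure.
Qed.
End Theta.
End Vertical.

(** * The averaging projection *)

Section Averaging.
Variables (k : fieldType) (X H : hopf k) (pi : {lrmorphism X -> H}).
Hypothesis pi_hopf : hopf_map pi.
Variable I : {linear H -> k^o}.
Hypothesis I_int : left_integral I.

Definition average (x : X) : X := slice (I \o pi) (Delta x).

(** With E(x) the average of x, left invariance of the integral gives
    ρ(E(x)) = x_(1) ⊗ π(x_(2)) ∫ π(x_(3)) = x_(1) ⊗ 1 ∫ π(x_(2)). *)
Lemma base_average x : base pi (average x).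
Proof.
rewrite /base /coinv /= -slice_tmap_l slice_tassoc.
have -> : tassoc (tmap (@rho k X H pi) idfun (Delta x)) =
    tmap idfun (tmap pi idfun \o Delta) (Delta x).
  transitivity (tassoc (tmap (tmap idfun pi) idfun (tmap Delta idfun (Delta x)))).
    by rewrite tmap_comp.
  by rewrite tassoc_tmap coassoc tmap_comp.
rewrite tmap_comp /average; apply: tmap_slice => y /=.
by rewrite -[RHS]I_int.1 pi_hopf.1 -[RHS]/(slice I _) !slice_tmap.
Qed.
End Averaging.

(** * Forms generated by K *)

Section HorizontalForms.
Variables (k : fieldType) (X H : hopf k) (OX : bicov X) (OH : bicov H).
Variables (pi : {lrmorphism X -> H}) (pis : dgmap OX OH).
Hypothesis pi_hopf : hopf_map pi.
Hypothesis pis_extends : extends pi pis.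
Hypothesis OXW : woronowicz OX.
Hypothesis OHW : woronowicz OH.

Definition kforms1 : {pred OX} :=
  lspan [set w | exists xi x, Kforms pis xi /\ w = val xi * cin x].

(** The image of K^{∧n} ⊗ X in Ω, see [formmul_kforms]. *)
Definition kforms (n : nat) : {pred OX} :=
  lspan [set w | exists (v : 'I_n -> L1 OX) x, (forall i, Kforms pis (v i)) /\
    w = (\prod_(i < n) val (v i)) * cin x].

(** Being the degree 1 part of the kernel of an algebra map, K.X is stable under
    multiplication by functions on either side. *)
Lemma kforms1P w : w \in kforms1 <-> homog 1 w /\ vertical pis w = 0.
Proof.
split=> [|[hw tw]]; last exact: (kernel_vertical pi_hopf pis_extends OXW OHW).
move=> /lspanP[s sK ->]; rewrite big_seq.
elim/big_ind: _ => [|u v [hu tu] [hv tv]|p /sK [xi [x [Kxi ->]]]].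
- by rewrite linear0; split=> //; exact: homog0.
- by rewrite linearD /= tu tv addr0; split=> //; exact: homogD.
have /asboolP[hxi _] := L1valP xi; split.
  apply: homogZ; rewrite -[1%N]addn0; apply: gprM => //; exact: homog_cin.
rewrite linearZ /=; have -> : vertical pis (val xi * cin x) = 0; last exact: scaler0.
transitivity (vertical pis (val xi) * vertical pis (cin x)); first exact: rmorphM.
by rewrite vertical_L1 [pis _]Kxi linear0r mul0r.
Qed.

Lemma kforms1_lmul x w : w \in kforms1 -> cin x * w \in kforms1.
Proof.
move=> /kforms1P[hw tw]; apply/kforms1P; split.
  by rewrite -[1%N]add0n; apply: gprM => //; exact: homog_cin.
transitivity (vertical pis (cin x) * vertical pis w); first exact: rmorphM.
by rewrite tw mulr0.
Qed.

Lemma kforms1_dbase b : base pi b -> dif (cin b) \in kforms1.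
Proof.
move=> bb; apply/kforms1P; split; last exact: (vertical_dbase pis_extends).
by apply: gpr_dif; exact: homog_cin.
Qed.

Lemma kforms_cons n xi w : Kforms pis xi -> w \in kforms n ->
  val xi * w \in kforms n.+1.
Proof.
move=> Kxi; apply: lspan_mull => _ [v [x [Kv ->]]]; apply: mem_lspan.
exists (fun i => if unlift ord0 i is Some j then v j else xi), x; split.
  by move=> i; case: unliftP.
rewrite big_ord_recl unlift_none mulrA; congr (_ * _ * _).
by apply: eq_bigr => i _; rewrite liftK.
Qed.

Lemma kforms_ind n (S : submodClosed OX) :
  (forall xi w, Kforms pis xi -> w \in kforms n -> val xi * w \in S) ->
  {subset kforms n.+1 <= S}.
Proof.
move=> KS; apply: lspan_min => _ [v [x [Kv ->]]].
rewrite big_ord_recl -mulrA; apply: KS => //; apply: mem_lspan.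
by exists (fun i => v (fintype.lift ord0 i)), x.
Qed.

Lemma kforms1_mul n (lmul : forall x w, w \in kforms n -> cin x * w \in kforms n)
    u w : u \in kforms1 -> w \in kforms n -> u * w \in kforms n.+1.
Proof.
move=> Nu Mw; move: u Nu; apply: lspan_mulr => _ [xi [x [Kxi ->]]].
by rewrite -mulrA; apply: kforms_cons => //; exact: lmul.
Qed.

(** As x ξ_1 lies in K.X, it is a sum of terms η y with η in K; by induction y
    moves past the remaining factors. *)
Lemma kforms_lmul n x w : w \in kforms n -> cin x * w \in kforms n.
Proof.
elim: n x w => [|n IH] x w.
  apply: lspan_mull => _ [v [y [_ ->]]]; apply: mem_lspan.
  exists v, (x * y); split=> [[]//|].
  by rewrite !big_ord0 !mul1r rmorphM.
apply: lspan_mull => _ [v [y [Kv ->]]].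
rewrite big_ord_recl -mulrA mulrA; apply: kforms1_mul => //.
  apply: kforms1_lmul; apply: mem_lspan; exists (v ord0), 1.
  by rewrite rmorph1 mulr1.
by apply: mem_lspan; exists (fun i => v (fintype.lift ord0 i)), y.
Qed.

Lemma kforms_prod n (v : 'I_n -> OX) : (forall i, v i \in kforms1) ->
  \prod_(i < n) v i \in kforms n.
Proof.
elim: n v => [|n IH] v Nv.
  apply: mem_lspan; exists (fun=> 0), 1; split=> [[]//|].
  by rewrite !big_ord0 rmorph1 mulr1.
rewrite big_ord_recl; apply: kforms1_mul => //; first exact: kforms_lmul.
by apply: IH.
Qed.

Lemma baseforms_kforms n w : baseforms OX pi n w -> w \in kforms n.
Proof.
apply: lspan_min => _ [v vB ->]; apply: kforms_prod => i.
move: (v i) (vB i) => u; apply: lspan_min => _ [b [c [bb bc ->]]].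
by apply: kforms1_lmul; exact: kforms1_dbase.
Qed.

Lemma baseforms_coinv n w : baseforms OX pi n w -> hcoact pi w = w ⊙ 1.
Proof.
pose f w : OX ⊗ H := hcoact pi w - w ⊙ 1.
have f_lin : linear f.
  by move=> a x y; rewrite /f linearP tpureDl tpureZl opprD addrACA -scalerBr.
pose fL : {linear OX -> OX ⊗ H} :=
  HB.pack f (GRing.isLinear.Build k OX (OX ⊗ H) *:%R f f_lin).
have f0 (A : set OX) : (forall v, A v -> hcoact pi v = v ⊙ 1) ->
    forall v, v \in lspan A -> hcoact pi v = v ⊙ 1.
  move=> A0 v Av; apply/eqP; rewrite -subr_eq0; apply/eqP.
  by apply: (linear_lspan0 (f := fL) _ Av) => u /A0 Au; rewrite /fL /= /f Au subrr.
apply: (f0) => _ [v vB ->]; elim/big_rec: _ => [|i w' _ IH]; first exact: rmorph1.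
transitivity (hcoact pi (v i) * hcoact pi w'); first exact: rmorphM.
rewrite IH; suff -> : hcoact pi (v i) = v i ⊙ 1 by rewrite tpureM mulr1.
move: (v i) (vB i) => u; apply: f0 => _ [b [c [bb bc ->]]].
transitivity (hcoact (OX := OX) pi (cin b) * hcoact (OX := OX) pi (dif (cin c))).
  exact: rmorphM.
rewrite hcoact_dif !hcoact_rho [rho pi b]bb [rho pi c]bc.
by rewrite !tmap_pure tpureM mulr1.
Qed.

Lemma formmul_kforms n w :
  w \in kforms n <-> exists2 t, KextX pis n t & formmul OX n t = w.
Proof.
split.
  apply: (lspan_lift (f := formmulL OXW n)) => _ [v [x [Kv ->]]].
  exists (qproj _ (tpows v) ⊙ x); last first.
    by rewrite [LHS](formmul_pure OXW) mulext_proj mulpow_tpows.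
  apply: mem_lspan; exists (qproj _ (tpows v)), x; split=> //.
  by apply: mem_lspan; exists v.
move=> [t Kt <-]; move: t Kt.
apply: (lspan_map (f := formmulL OXW n)) => _ [q [x [Kq ->]]].
rewrite -[formmulL _ _ _]/(formmul OX n (q ⊙ x)) (formmul_pure OXW).
move: q Kq => _ /lspanP[s sK ->].
rewrite linear_sum mulr_suml big_seq; apply: rpred_sum => p /sK [v Kv ->].
rewrite linearZ /= -scalerAl; apply: rpredZ; apply: mem_lspan.
by exists v, x; split=> //; rewrite -mulpow_tpows -(mulext_proj OXW).
Qed.

(** * Forms generated by dB *)

(** The space (dB)^n X. *)
Definition dbforms (n : nat) : {pred OX} :=
  lspan [set w | exists (b : 'I_n -> X) x, (forall i, base pi (b i)) /\
    w = (\prod_(i < n) dif (cin (b i))) * cin x].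

Hypothesis pi_condK : condK pi pis.

(** Condition K gives K M_n ⊂ dB X M_n ⊂ dB M_n, M_n being the n-th space of
    [kforms]. *)
Lemma kforms_dbforms n : {subset kforms n <= dbforms n}.
Proof.
elim: n => [|n IH].
  apply: lspan_min => _ [v [x [_ ->]]]; apply: mem_lspan.
  by exists (fun=> 0), x; split=> [[]//|]; rewrite !big_ord0.
apply: kforms_ind => xi w Kxi Mw.
move: (val xi) (pi_condK Kxi) => u; apply: lspan_mulr => _ [b [x [bb ->]]].
rewrite -mulrA; move: (cin x * w) (IH _ (kforms_lmul x Mw)) => {}u.
apply: lspan_mull => _ [v [y [bv ->]]]; apply: mem_lspan.
exists (fun i => if unlift ord0 i is Some j then v j else b), y; split.
  by move=> i; case: unliftP.
rewrite big_ord_recl unlift_none mulrA; congr (_ * _ * _).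
by apply: eq_bigr => i _; rewrite liftK.
Qed.

Lemma dbase_baseforms1 b : base pi b -> baseforms1 pi (dif (cin b) : OX).
Proof.
move=> bb; apply: mem_lspan; exists 1, b; split=> //; first exact: base1.
by rewrite rmorph1 mul1r.
Qed.

Lemma dbase_mul_baseforms1 b c : base pi b -> base pi c ->
  baseforms1 pi (dif (cin b) * cin c : OX).
Proof.
move=> bb bc.
have -> : dif (cin b) * cin c = dif (cin (b * c)) - cin b * dif (cin c) :> OX.
  by rewrite rmorphM /= (difM _ (homog_cin _ _)) scale1r addrK.
apply: rpredB; first by apply: dbase_baseforms1; exact: baseM.
by apply: mem_lspan; exists b, c.
Qed.

Lemma dbprod_coinv n (b : 'I_n -> X) : (forall i, base pi (b i)) ->
  hcoact (OX := OX) pi (\prod_(i < n) dif (cin (b i))) =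
  (\prod_(i < n) dif (cin (b i))) ⊙ 1.
Proof.
move=> bb; apply: (@baseforms_coinv n); apply: mem_lspan.
by exists (fun i => dif (cin (b i))) => // i; exact: dbase_baseforms1.
Qed.

(** The last factor absorbs c; this needs at least one factor. *)
Lemma dbprod_baseforms n (b : 'I_n -> X) c : (0 < n)%N ->
  (forall i, base pi (b i)) -> base pi c ->
  baseforms OX pi n ((\prod_(i < n) dif (cin (b i))) * cin c).
Proof.
case: n b => // n b _ bb bc; rewrite big_ord_recr -mulrA; apply: mem_lspan.
exists (fun i => if i == ord_max then dif (cin (b i)) * cin c
                 else dif (cin (b i))).
  by move=> i; case: eqP => _; [exact: dbase_mul_baseforms1|exact: dbase_baseforms1].
rewrite big_ord_recr /= eqxx; congr (_ * _); apply: eq_bigr => i _.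
by rewrite -val_eqE /= ltn_eqF.
Qed.

Variable I : {linear H -> k^o}.
Hypothesis I_int : left_integral I.

(** The projection w |-> w_[0] ∫ w_[1] fixes w, is linear over coinvariant forms
    and maps X to B. *)
Lemma dbforms_coinv n w : (0 < n)%N -> w \in dbforms n ->
  hcoact pi w = w ⊙ 1 -> baseforms OX pi n w.
Proof.
move=> n0 Dw wco; have -> : w = slice I (hcoact pi w).
  by rewrite wco slice_pure I_int.2 scale1r.
move: w Dw {wco}; pose f : {linear OX -> OX} := slice I \o hcoact pi.
apply: (lspan_map (f := f)) => _ [b [x [bb ->]]].
set u := \prod_(i < n) _.
have -> : f (u * cin x) = u * cin (average pi I x).
  rewrite /f /=.
  transitivity (slice I (hcoact pi u * hcoact (OX := OX) pi (cin x))).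
    by congr (slice I _); exact: rmorphM.
  rewrite dbprod_coinv // hcoact_cin.
  transitivity (u * slice I (tmap cin pi (Delta x))).
    elim/tens_ind: (tmap cin pi _) => [|y h s IH].
      by rewrite !(mulr0, slice0).
    rewrite mulrDr !sliceD IH mulrDr; congr (_ + _).
    by rewrite tpureM !slice_pure mul1r -scalerAr.
  by rewrite slice_tmap.
by apply: dbprod_baseforms => //; exact: base_average.
Qed.
End HorizontalForms.

Theorem theorem9p11 (k : fieldType) (X H : hopf k)
    (OX : bicov X) (OH : bicov H)
    (OX_woronowicz : woronowicz OX) (OH_woronowicz : woronowicz OH)
    (pi : {lrmorphism X -> H}) (pi_hopf : hopf_map pi)
    (pi_surj : surjective pi)
    (pis : dgmap OX OH) (pis_extends : extends pi pis)
    (pi_condK : condK pi pis)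
    (H_integral : exists I : {linear H -> k^o}, left_integral I) :
  forall n : nat, (1 <= n)%N ->
    baseforms OX pi n =
    formmul OX n @` (KextX pis n `&` coinv (coactextX OX pi n)).
Proof.
move=> n n0; have [I I_int] := H_integral; apply/seteqP; split=> w.
  move=> Bw.
  have := baseforms_kforms pi_hopf pis_extends OX_woronowicz OH_woronowicz Bw.
  move=> /(formmul_kforms _ OX_woronowicz)[t Kt tw]; exists t => //; split=> //.
  by apply/(coinv_formmul pi OX_woronowicz); rewrite tw; exact: baseforms_coinv Bw.
move=> [t [Kt ct] <-].
apply: (dbforms_coinv pi_hopf I_int n0); last first.
  by apply/(coinv_formmul pi OX_woronowicz).
apply: (kforms_dbforms pi_hopf pis_extends OX_woronowicz OH_woronowicz pi_condK).
by apply/(formmul_kforms _ OX_woronowicz); exists t.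
Qed.
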